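(* Let $P$ be a probability transition kernel on the finite or countable alphabet $G$, with $a_k$, $\beta_m$, $\rho_m$, $\underline U$, $\Phi$ defined from $P$ as in the context. (i) Every probability measure $\mu$ on $G^{\mathbb Z}$ compatible with $P$ has the following loss-of-memory property: if $f:G^{\mathbb Z}\to\mathbb R$ is a bounded function depending only on the coordinates in a finite interval $[s,t]\subset\mathbb Z$ and $i\le s$, then $$\Bigl|\mu\bigl(f\mid \eta(j)=w_j,\ j<i\bigr)-\mu\bigl(f\mid\eta(j)=v_j,\ j<i\bigr)\Bigr|\;\le\;2\,\|f\|_\infty\sum_{j=0}^{t-s}\rho_{s+j-i}$$ for every $\underline w,\underline v\in G^{\mathbb Z}$. (ii) If $\sum_{m\ge0}\beta_m=\infty$, the law $\mu:=\mathbb P(\Phi(\underline U)\in\cdot\,)$ of $\Phi(\underline U)$ is the unique probability measure on $G^{\mathbb Z}$ compatible with $P$.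
   Context: Notation. $\mathbb N=\{0,1,2,\dots\}$, $\mathbb N^*=\mathbb N\setminus\{0\}$, $-\mathbb N^*=\{-i:i\in\mathbb N^*\}$. Intervals $[s,t]$ are intervals of integers. $G$ is a finite or countable set (alphabet), enumerated as $g_1,g_2,\dots$. Elements of $G^{-\mathbb N^*}$ are histories $w_{-\infty}^{-1}=(w_{-1},w_{-2},\dots)$, and $w_{-k}^{-1}=(w_{-1},\dots,w_{-k})$. $P:G\times G^{-\mathbb N^*}\to[0,1]$ is a probability transition kernel: $P(g\mid w_{-\infty}^{-1})\ge 0$ and $\sum_{g\in G}P(g\mid w_{-\infty}^{-1})=1$ for every history (measurable in the history). Compatibility. With $\eta(i)$, $i\in\mathbb Z$, the coordinate maps on $G^{\mathbb Z}$, a probability measure $\nu$ on $G^{\mathbb Z}$ is compatible with $P$ if for all $i\in\mathbb Z$, $g\in G$, $\nu(\eta(i)=g\mid \eta(i+j)=w_j,\ j\in-\mathbb N^* )=P(g\mid w_{-\infty}^{-1})$ for $\nu$-almost every past $w_{-\infty}^{-1}$. Conditional expectations. For $\mu$ compatible with $P$ and $f$ depending on $[s,t]$, $i\le s$, the symbol $\mu(f\mid\eta(j)=w_j,\ j<i)$ denotes the (everywhere defined) version of the conditional expectation given by $P$: $\sum_{g_i,\dots,g_t\in G} f(g_s,\dots,g_t)\prod_{k=i}^t P(g_k\mid g_{k-1},\dots,g_i,w_{i-1},w_{i-2},\dots)$. The numbers $a_k$. $a_0(g)=\inf\{P(g\mid z_{-\infty}^{-1}): z_{-\infty}^{-1}\in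 G^{-\mathbb N^*}\}$; for $k\ge1$, $a_k(g\mid w_{-k}^{-1})=\inf\{P(g\mid w_{-1},\dots,w_{-k},z_{-1},z_{-2},\dots): z_{-\infty}^{-1}\in G^{-\mathbb N^*}\}$ (for $k=0$, $a_0(g\mid w_0^{-1})$ means $a_0(g)$); and $a_k=\inf_{w_{-k}^{-1}}\sum_{g\in G}a_k(g\mid w_{-k}^{-1})$, $k\in\mathbb N$. Set $\beta_m=\prod_{k=0}^m a_k$. The numbers $\rho_m$. $\rho_m$ is the probability that the Markov chain on $\mathbb N$ started at $0$ at time $0$, with transition probabilities $p(x,x+1)=a_x$, $p(x,0)=1-a_x$, and $p(x,y)=0$ otherwise, is at $0$ at time $m$ (so $\rho_0=1$). The map $\Phi$. $\underline U=(U_i)_{i\in\mathbb Z}$ are i.i.d. uniform on $[0,1[$ under $\mathbb P$. For $\underline u\in[0,1[^{\mathbb Z}$ let $\tau[n](\underline u)=\max\{m\le n: u_k<a_{k-m}\text{ for all }k\in[m,n]\}$, with $\max\emptyset=-\infty$. Put $b_0(g)=a_0(g)$ and, for $k\ge1$, $b_k(g\mid w_{-k}^{-1})=a_k(g\mid w_{-k}^{-1})-a_{k-1}(g\mid w_{-k+1}^{-1})$. For each history, let $\mathbf B_k(g\mid w_{-k}^{-1})$, $k\in\mathbb N$, $g\in G$ (written $\mathbf B_0(g)$ for $k=0$), be the intervals, closed on the left and open on the right, of length $b_k(g\mid w_{-k}^{-1})$, placed consecutively starting at $0$ in the order $\mathbf B_0(g_1),\mathbf B_0(g_2),\dots,\mathbf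 B_1(g_1\mid w_{-1}^{-1}),\mathbf B_1(g_2\mid w_{-1}^{-1}),\dots,\mathbf B_2(g_1\mid w_{-2}^{-1}),\dots$. For $\ell\le k$ let $\mathbf B_{\ell,k}(g\mid w_{-1},\dots,w_{-k})=[0,a_k[\,\cap\,\mathbf B_\ell(g\mid w_{-\ell}^{-1})$. Fix an arbitrary $g_0\in G$. Then $\Phi(\underline u)=\underline x=(x_n)_{n\in\mathbb Z}$, also written $\Phi(\underline u)(n)=x_n$, where: if $\tau[n](\underline u)=-\infty$, $x_n=g_0$; if $\tau=\tau[n](\underline u)>-\infty$, then recursively for $j=\tau,\tau+1,\dots,n$, $x_j$ is the unique $g\in G$ such that $u_j\in\bigcup_{0\le \ell\le j-\tau}\mathbf B_{\ell,j-\tau}(g\mid x_{j-1},\dots,x_\tau)$. *)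

(* Defs.v *)
From HB Require Import structures.
From mathcomp Require Import all_boot all_order all_algebra.
From mathcomp Require Import all_classical all_reals all_analysis.

Set Implicit Arguments.
Unset Strict Implicit.
Unset Printing Implicit Defensive.

Import Order.TTheory GRing.Theory Num.Theory.
Import numFieldNormedType.Exports.

Local Open Scope classical_set_scope.
Local Open Scope ring_scope.

(* Generators of the product sigma-algebra on I -> G, each factor carrying the
   discrete sigma-algebra (the alphabets below are countable). *)
Definition cylinders (I : Type) (G : pointedType) : set (set (I -> G)) :=
  [set B | exists (i : I) (A : set G), B = [set x | A (x i)]].

Notation paths I G := (g_sigma_algebraType (@cylinders I G)).

(* A history (w_{-1}, w_{-2}, ...) is a function h : nat -> G with
   h k = w_{-(k+1)}.  A finite word (w_{-1}, ..., w_{-k}) is a seq of size k,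
   most recent letter first. *)

Definition past (G : Type) (i : int) (x : int -> G) : nat -> G :=
  fun k => x (i - k.+1%:Z).

Definition prepend (G : Type) (s : seq G) (z : nat -> G) : nat -> G :=
  fun k => nth (z (k - size s)%N) s k.

Definition transition_kernel (R : realType) (G : pointedType)
    (P : G -> (nat -> G) -> R) : Prop :=
  [/\ forall g w, 0 <= P g w,
      forall w, (\esum_(g in [set: G]) (P g w)%:E = 1)%E
    & forall g, measurable_fun [set: paths nat G] (P g : paths nat G -> R)].

(* q (h x) is a version of the conditional probability of E given h *)
Definition cond_prob_version d d' (T : measurableType d)
    (S : measurableType d') (R : realType) (nu : probability T R)
    (E : set T) (h : T -> S) (q : S -> R) : Prop :=
  forall C : set S, measurable C ->
    (nu (E `&` h @^-1` C) = \int[nu]_(x in h @^-1` C) (q (h x))%:E)%E.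

Definition compatible (R : realType) (G : pointedType)
    (P : G -> (nat -> G) -> R) (nu : probability (paths int G) R) : Prop :=
  forall (i : int) (g : G),
    cond_prob_version nu [set x : paths int G | x i = g]
      (past i : paths int G -> paths nat G) (P g).

(* Sum of an absolutely summable real family; needed because esum is only
   meaningful for nonnegative families. *)
Definition rsum (R : realType) (T : choiceType) (D : set T) (F : T -> R) : R :=
  fine (\esum_(x in D) (F^\+ x)%:E) - fine (\esum_(x in D) (F^\- x)%:E).

(* The configuration equal to w on ]-oo, i[ and to r_0, r_1, ... on
   i, i+1, ..., i + size r - 1; here r is in chronological order. *)
Definition glue (G : Type) (i : int) (r : seq G) (w : int -> G) : int -> G :=
  fun j => if j < i then w j else nth (w j) r `|j - i|%N.

(* The everywhere defined version, given by P, of the conditional expectation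
   of f given eta(j) = w_j for all j < i, for f depending on coordinates <= t.
   The word r is (g_i, ..., g_t). *)
Definition cond_exp (R : realType) (G : pointedType) (P : G -> (nat -> G) -> R)
    (i t : int) (f : (int -> G) -> R) (w : int -> G) : R :=
  rsum [set r : seq G | size r = `|t - i|.+1]
    (fun r => let x := glue i r w in
       f x * \prod_(k < size r) P (x (i + k%:Z)) (past (i + k%:Z) x)).

Definition depends_on (R G : Type) (s t : int) (f : (int -> G) -> R) : Prop :=
  forall x y : int -> G, (forall j, s <= j <= t -> x j = y j) -> f x = f y.

Definition sup_norm (R : realType) (T : Type) (f : T -> R) : R :=
  sup (range (fun x => `|f x|)).

(* a_word P s g is a_k(g | w_{-k}^{-1}) for s = (w_{-1}, ..., w_{-k}),
   and a_num P k is the number a_k. *)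
Definition a_word (R : realType) (G : pointedType) (P : G -> (nat -> G) -> R)
    (s : seq G) (g : G) : R :=
  inf (range (fun z : nat -> G => P g (prepend s z))).

Definition a_num (R : realType) (G : pointedType) (P : G -> (nat -> G) -> R)
    (k : nat) : R :=
  inf [set fine (\esum_(g in [set: G]) (a_word P s g)%:E) |
        s in [set s : seq G | size s = k]].

Definition beta (R : realType) (G : pointedType) (P : G -> (nat -> G) -> R)
    (m : nat) : R :=
  \prod_(k < m.+1) a_num P k.

(* The law at time m of the Markov chain on nat with transition probabilities
   p started at x0, i.e. the m-step transition probability from x0 to y. *)
Fixpoint chain_law (R : realType) (p : nat -> nat -> R) (x0 m : nat) :
    nat -> \bar R :=
  if m is m'.+1 then
    fun y => (\sum_(0 <= x <oo) chain_law p x0 m' x * (p x y)%:E)%E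
  else fun y => (y == x0)%:R%:E.

Definition house_of_cards (R : realType) (a : nat -> R) (x y : nat) : R :=
  if y == x.+1 then a x else if y == 0%N then 1 - a x else 0.

Definition rho (R : realType) (G : pointedType) (P : G -> (nat -> G) -> R)
    (m : nat) : R :=
  fine (chain_law (house_of_cards (a_num P)) 0 m 0).

(* b_word P s g is b_k(g | w_{-k}^{-1}) for s = (w_{-1}, ..., w_{-k}). *)
Definition b_word (R : realType) (G : pointedType) (P : G -> (nat -> G) -> R)
    (s : seq G) (g : G) : R :=
  if s is [::] then a_word P [::] g
  else a_word P s g - a_word P (take (size s).-1 s) g.

(* The enumeration g_1, g_2, ... of the alphabet is encoded by the injective
   position function rk; only the order it induces is used.  The left endpoint
   of B_k(g | s) is the total length of the intervals placed before it. *)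
Definition B_left (R : realType) (G : pointedType) (rk : G -> nat)
    (P : G -> (nat -> G) -> R) (s : seq G) (g : G) : \bar R :=
  (\sum_(l < size s) \esum_(h in [set: G]) (b_word P (take l s) h)%:E
   + \esum_(h in [set h | (rk h < rk g)%N]) (b_word P s h)%:E)%E.

Definition B_int (R : realType) (G : pointedType) (rk : G -> nat)
    (P : G -> (nat -> G) -> R) (s : seq G) (g : G) : set R :=
  [set v : R | (B_left rk P s g <= v%:E < B_left rk P s g
                                          + (b_word P s g)%:E)%E].

(* B_{l,k}(g | s) for a word s of size k >= l *)
Definition B_cut (R : realType) (G : pointedType) (rk : G -> nat)
    (P : G -> (nat -> G) -> R) (l : nat) (s : seq G) (g : G) : set R :=
  `[0, a_num P (size s)[ `&` B_int rk P (take l s) g.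

(* tau[n](u), with None standing for -oo *)
Definition tau (R : realType) (G : pointedType) (P : G -> (nat -> G) -> R)
    (u : int -> R) (n : int) : option int :=
  let S := [set m : int | m <= n /\
              forall k : int, m <= k <= n -> u k < a_num P `|k - m|%N] in
  xget None (Some @` (S `&` ubound S)).

Definition letter (R : realType) (G : pointedType) (rk : G -> nat)
    (P : G -> (nat -> G) -> R) (g0 : G) (v : R) (s : seq G) : G :=
  xget g0 [set g | exists2 l : nat, (l <= size s)%N & B_cut rk P l s g v].

(* The word (x_{m+n-1}, ..., x_m) produced by the recursion started at m. *)
Fixpoint generate (R : realType) (G : pointedType) (rk : G -> nat)
    (P : G -> (nat -> G) -> R) (g0 : G) (u : int -> R) (m : int) (n : nat) :
    seq G :=
  if n is n'.+1 then
    let s := generate rk P g0 u m n' in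
    letter rk P g0 (u (m + n'%:Z)) s :: s
  else [::].

Definition Phi (R : realType) (G : pointedType) (rk : G -> nat)
    (P : G -> (nat -> G) -> R) (g0 : G) (u : int -> R) : int -> G :=
  fun n => if tau P u n is Some m
           then head g0 (generate rk P g0 u m `|n - m|.+1)
           else g0.

Definition mutually_independent d d' (T : measurableType d)
    (S : measurableType d') (R : realType) (Pr : probability T R)
    (I : choiceType) (X : I -> T -> S) : Prop :=
  forall (J : seq I) (A : I -> set S), uniq J ->
    (forall j, measurable (A j)) ->
    (Pr (\bigcap_(j in [set` J]) (X j @^-1` A j)) =
     \prod_(j <- J) Pr (X j @^-1` A j))%E.

Definition iid_uniform d (T : measurableType d) (R : realType)
    (Pr : probability T R) (U : int -> {RV Pr >-> R}) : Prop :=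
  [/\ forall i x, 0 <= U i x < 1,
      forall i (A : set R), measurable A ->
        distribution Pr (U i) A = uniform_prob (@ltr01 R) A
    & mutually_independent Pr (fun i => U i : T -> R)].

(* Main.v *)
(* Everything follows from one lower bound.  Suppose that only the last k letters
   w_{-1}, ..., w_{-k} of the past are known.  The next letter is g with
   probability at least a_k(g | w_{-k}^{-1}), in which case k + 1 letters are
   known; on the remaining mass, at most 1 - a_k, forget everything.  The number of
   known letters dominates the house-of-cards chain, so for phi >= 0 depending on
   the last L letters this yields a number [low phi n], the same for all pasts and
   all compatible measures, below the expectation of phi after n steps, and
   low phi n + low (c - phi) n >= c P(W_n >= L).  Hence two such expectations differ
   by at most c P(W_n < L) <= c sum_{j < L} rho_{n-j}; as (a_k) is nondecreasing,
   (rho_m) is nonincreasing and (i) follows.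

   Decomposing at the last visit to 0 gives rho_n (1 + sum_{m < n} beta_m) <= 1.
   So if sum_m beta_m diverges, rho_n -> 0, which gives uniqueness and a_k -> 1, and
   also tau[n] > -oo almost surely, since P(tau[n] < m) = rho_{n+1-m}.  Then X_n is the
   letter selected by U_n from the past of X, and U_n is independent of that past, so
   P(X_n = g, past in C) >= a_k(g | s) P(past in C) whenever C fixes the last letters
   to be s.  Summed over g and s, these lower bounds lose at most the fraction
   1 - a_k of the mass, so letting k tend to infinity turns them into equalities. *)

Require Import Defs.
From HB Require Import structures.
From mathcomp Require Import all_boot all_order all_algebra.
From mathcomp Require Import all_classical all_reals all_analysis.
From mathcomp Require Import measurable_realfun.
From mathcomp Require Import ring lra zify.

Set Implicit Arguments.
Unset Strict Implicit.
Unset Printing Implicit Defensive.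

Import Order.TTheory GRing.Theory Num.Theory.
Import numFieldNormedType.Exports.

Local Open Scope classical_set_scope.
Local Open Scope ring_scope.

(** * The house-of-cards chain *)

Section house_of_cards_chain.
Variables (R : realType) (a : nat -> R).
Hypotheses (a01 : forall k, 0 <= a k <= 1) (a_nd : {homo a : k l / (k <= l)%N >-> k <= l}).

(* [iter n hoc_op psi k] is the expectation of [psi] at time [n] for the chain
   started at [k]. *)
Definition hoc_op (psi : nat -> R) (k : nat) : R :=
  a k * psi k.+1 + (1 - a k) * psi 0%N.

Definition unit_mass (y k : nat) : R := (k == y)%:R.

Definition hoc_rho (n : nat) : R := iter n hoc_op (unit_mass 0) 0.

Lemma iter_hoc_ext n psi phi : psi =1 phi ->
  iter n hoc_op psi =1 iter n hoc_op phi.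
Proof. by move=> /funext ->. Qed.

Lemma iter_hoc_scale n c psi k :
  iter n hoc_op (fun x => c * psi x) k = c * iter n hoc_op psi k.
Proof. by elim: n k => //= n IH k; rewrite /hoc_op !IH; ring. Qed.

Lemma iter_hoc_cst n c k : iter n hoc_op (fun=> c) k = c.
Proof. by elim: n k => //= n IH k; rewrite /hoc_op !IH; ring. Qed.

Lemma iter_hoc_le n psi phi : (forall k, psi k <= phi k) ->
  forall k, iter n hoc_op psi k <= iter n hoc_op phi k.
Proof.
move=> le; elim: n => //= n IH k; have /andP[a0 a1] := a01 k.
by rewrite lerD// ler_wpM2l// subr_ge0.
Qed.

(** A higher state has a larger [a], which moves mass from [psi 0] to the smaller value at the next
    state; that value also decreases along the states. *)
Lemma iter_hoc_noninc n psi : {homo psi : k l / (k <= l)%N >-> l <= k} ->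
  {homo iter n hoc_op psi : k l / (k <= l)%N >-> l <= k}.
Proof.
move=> nd; elim: n => //= n IH k l kl.
have /andP[a0 a1] := a01 k; have /andP[b0 b1] := a01 l.
have le1 : iter n hoc_op psi l.+1 <= iter n hoc_op psi k.+1 by apply: IH.
have le2 : iter n hoc_op psi l.+1 <= iter n hoc_op psi 0%N by apply: IH.
have := a_nd kl; rewrite /hoc_op => akl.
by nra.
Qed.

Lemma unit_mass_noninc : {homo unit_mass 0 : k l / (k <= l)%N >-> l <= k}.
Proof. by move=> [|k] [|l]; rewrite /unit_mass. Qed.

(** Conditioning on the first step makes [hoc_rho n.+1] a convex combination of the probabilities of
    being at 0 after [n] steps from 1 and from 0, the former being the smaller. *)
Lemma hoc_rho_noninc : {homo hoc_rho : m n / (m <= n)%N >-> n <= m}.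
Proof.
apply: homo_leq => [//|x y z xy yz|n]; first exact: le_trans yz xy.
rewrite /hoc_rho /= /hoc_op; have /andP[a0 a1] := a01 0%N.
have := iter_hoc_noninc n unit_mass_noninc (leq0n 1); nra.
Qed.

Lemma iter_hoc_unit_mass0 n x k : (k + n < x)%N -> iter n hoc_op (unit_mass x) k = 0.
Proof.
elim: n k => [|n IH] k kx /=; first by rewrite /unit_mass ltn_eqF// -(addn0 k).
by rewrite /hoc_op !IH ?mulr0 ?addr0//; lia.
Qed.

(** The chain climbs at most one unit per step, so the states from [N] on are out of reach. *)
Lemma iter_hoc_expand n psi k N : (k + n < N)%N ->
  iter n hoc_op psi k = \sum_(x < N) psi x * iter n hoc_op (unit_mass x) k.
Proof.
elim: n k => [|n IH] k kN /=.
  rewrite addn0 in kN; rewrite (bigD1 (Ordinal kN))//= /unit_mass eqxx mulr1.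
  by rewrite big1 ?addr0// => i; rewrite -val_eqE/= eq_sym => /negbTE->; rewrite mulr0.
rewrite /hoc_op (IH k.+1) ?(IH 0%N); [|lia..].
by rewrite !big_distrr -big_split/=; apply: eq_bigr => i _; ring.
Qed.

Lemma iter_hoc_unit_massS n y :
  iter n.+1 hoc_op (unit_mass y.+1) 0 = a y * iter n hoc_op (unit_mass y) 0.
Proof.
rewrite iterSr -iter_hoc_scale; apply: iter_hoc_ext => k.
by rewrite /hoc_op /unit_mass eqSS mulr0 addr0; case: eqVneq => [->//|_]; rewrite !mulr0.
Qed.

(** To be at [y] at time [n] is to be at 0 at time [n - y] and then to climb [y] times in a row. *)
Lemma iter_hoc_unit_massE n y : (y <= n)%N ->
  iter n hoc_op (unit_mass y) 0 = hoc_rho (n - y) * \prod_(i < y) a i.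
Proof.
elim: n y => [|n IH] [|y]// yn; rewrite ?subn0 ?big_ord0 ?mulr1//.
by rewrite iter_hoc_unit_massS IH// subSS big_ord_recr/=; ring.
Qed.

Lemma prod_a01 n : 0 <= \prod_(i < n) a i <= 1.
Proof.
rewrite prodr_ge0 => [|i _]; last by case/andP: (a01 i).
elim: n => [|n IH]; first by rewrite big_ord0 lexx.
rewrite big_ord_recr/=.
by have /andP[? ?] := a01 n; rewrite mulr_ile1// prodr_ge0// => i _; case/andP: (a01 i).
Qed.

Lemma hoc_rho_ge0 n : 0 <= hoc_rho n.
Proof.
rewrite -(iter_hoc_cst n 0 0); apply: iter_hoc_le => k.
by rewrite /unit_mass ler0n.
Qed.

Lemma iter_hoc_unit_mass_le n y : iter n hoc_op (unit_mass y) 0 <= hoc_rho (n - y).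
Proof.
case: (leqP y n) => yn; last by rewrite iter_hoc_unit_mass0// hoc_rho_ge0.
have /andP[? ?] := prod_a01 y.
by rewrite iter_hoc_unit_massE// ler_piMr// hoc_rho_ge0.
Qed.

Lemma iter_hoc_below_le n L :
  iter n hoc_op (fun k => (k < L)%:R) 0 <= \sum_(x < L) hoc_rho (n - x).
Proof.
rewrite (@iter_hoc_expand _ _ _ (L + n.+1)); last lia.
rewrite big_split_ord/= [X in _ + X]big1 ?addr0 => [|i _]; last first.
  by rewrite ltnNge leq_addr mul0r.
by apply: ler_sum => i _; rewrite ltn_ord mul1r iter_hoc_unit_mass_le.
Qed.

(* Splitting according to the last visit to 0 before time [n]. *)
Lemma hoc_rho_sum n :
  hoc_rho n * \sum_(m < n) \prod_(i < m.+1) a i <= 1.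
Proof.
rewrite -[leRHS](iter_hoc_cst n 1 0) (@iter_hoc_expand _ _ _ n.+1) ?add0n//.
(* The state 0 is dropped; the states 1, ..., [n] contribute the products in the sum. *)
rewrite big_ord_recl mul1r mulr_sumr -[leLHS]add0r; apply: lerD; first exact: hoc_rho_ge0.
apply: ler_sum => i _; rewrite mul1r iter_hoc_unit_massE; last exact: leq_ord.
have /andP[? ?] := prod_a01 (bump 0 i).
by rewrite ler_wpM2r// hoc_rho_noninc// leq_subr.
Qed.

Lemma house_of_cardsE x y : house_of_cards a x y = hoc_op (unit_mass y) x.
Proof.
rewrite /house_of_cards /hoc_op /unit_mass.
by case: y => [|y]/=; rewrite ?eqSS ?[y == x]eq_sym; [|case: eqP => _];
  rewrite ?mulr0 ?mulr1 ?addr0 ?add0r.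
Qed.

Lemma chain_lawE n y :
  chain_law (house_of_cards a) 0 n y = (iter n hoc_op (unit_mass y) 0)%:E.
Proof.
elim: n y => [|n IH] y /=; first by rewrite /unit_mass eq_sym.
pose c x := iter n hoc_op (unit_mass x) 0 * house_of_cards a x y.
have cE x : (chain_law (house_of_cards a) 0 n x * (house_of_cards a x y)%:E)%E
    = (c x)%:E by rewrite IH.
under eq_eseriesr do rewrite cE.
have -> : hoc_op (iter n hoc_op (unit_mass y)) 0 = \sum_(x < n.+1) c x.
  rewrite -iterS iterSr (@iter_hoc_expand _ _ _ n.+1) ?add0n//; apply: eq_bigr => x _.
  by rewrite /c house_of_cardsE mulrC.
(* The partial sums are constant from [n.+1] terms on, since at time [n] the chain is at most at
   [n]. *)
apply/cvg_lim => //; apply: (@cvg_near_cst _ _ _ _ _ _).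
exists n.+1 => // m /= nm.
rewrite sumEFin; congr EFin; rewrite -(big_mkord xpredT) /=.
rewrite (big_cat_nat (leq0n n.+1) nm)/= [X in _ + X]big1_seq ?addr0// => x.
by rewrite mem_index_iota /c => /andP[_ /andP[nx _]]; rewrite iter_hoc_unit_mass0 ?mul0r.
Qed.

Hypothesis sum_prod : (\sum_(0 <= m <oo) (\prod_(i < m.+1) a i)%:E = +oo)%E.

(** If [hoc_rho] stayed above [e], then [hoc_rho_sum] would bound the partial sums of a divergent
    series by [e^-1]. *)
Lemma hoc_rho_small e : 0 < e -> exists n, hoc_rho n <= e.
Proof.
move=> e0; apply/not_existsP => small.
have big n : \sum_(m < n) \prod_(i < m.+1) a i <= e^-1.
  have /negP := small n; rewrite -ltNge => egt.
  rewrite -[e^-1]mul1r ler_pdivlMr//; apply: le_trans (hoc_rho_sum n).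
  rewrite mulrC ler_wpM2r ?(ltW egt)//; apply: sumr_ge0 => i _.
  by have /andP[] := prod_a01 i.+1.
suff : (+oo <= (e^-1)%:E :> \bar R)%E by [].
rewrite -sum_prod; apply: lime_le.
  by apply: is_cvg_nneseries => n _ _; rewrite lee_fin; have /andP[] := prod_a01 n.+1.
by apply: nearW => n; rewrite sumEFin lee_fin big_mkord.
Qed.

(** Otherwise every state falls back to 0 with probability above [e], which keeps [hoc_rho] at least
    [e] at all positive times, against [hoc_rho_small]. *)
Lemma a_near1 e : 0 < e -> exists k, 1 - a k <= e.
Proof.
move=> e0; apply/not_existsP => small.
have [n le] : exists n, hoc_rho n <= e / 2 by apply: hoc_rho_small; rewrite divr_gt0.
have : e <= hoc_rho n.+1.
  rewrite /hoc_rho iterSr -(iter_hoc_cst n e 0); apply: iter_hoc_le => k.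
  have /negP := small k; rewrite -ltNge /hoc_op /unit_mass/= => /ltW.
  by rewrite mulr0 mulr1 add0r.
have := hoc_rho_noninc (leqnSn n); lra.
Qed.

End house_of_cards_chain.

(** * Sums over arbitrary sets *)

Section esum_lemmas.
Variables (R : realType) (T : choiceType).
Implicit Types (D : set T) (f : T -> \bar R).

Lemma esumZl D (c : R) f : 0 <= c -> (forall x, 0 <= f x)%E ->
  (\esum_(x in D) (c%:E * f x) = c%:E * \esum_(x in D) f x)%E.
Proof.
rewrite le_eqVlt => /predU1P[<- _|c0 f0].
  by rewrite mul0e esum1// => x _; rewrite mul0e.
(* One inequality for all factors is enough: the converse is the factor [c^-1] applied to
   [c * f]. *)
have le (k : R) (g : T -> \bar R) : 0 < k -> (forall x, 0 <= g x)%E ->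
    (\esum_(x in D) (k%:E * g x) <= k%:E * \esum_(x in D) g x)%E.
  move=> k0 g0; apply: ge_ereal_sup => _ [X [finX XD] <-].
  rewrite -ge0_mule_fsumr// lee_pmul2l//.
  by apply: ereal_sup_ubound; exists X.
apply/eqP; rewrite eq_le le//=.
have := le c^-1 (fun x => c%:E * f x)%E; rewrite invr_gt0 => /(_ c0).
under eq_esum do rewrite muleA -EFinM mulVf ?gt_eqF// mul1e.
rewrite -(@lee_pmul2l _ c%:E)// muleA -EFinM divff ?gt_eqF// mul1e; apply => x.
by rewrite mule_ge0// lee_fin ltW.
Qed.

(** The excess [p - al] has total mass [B - A] and meets values of [f] that are at least [l]. *)
Lemma esum_mix (al p : T -> R) (A B l : R) f :
  (forall g, 0 <= al g <= p g) -> 0 <= l -> (forall g, l%:E <= f g)%E ->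
  (\esum_(g in setT) (al g)%:E = A%:E)%E -> (\esum_(g in setT) (p g)%:E = B%:E)%E ->
  (\esum_(g in setT) ((al g)%:E * f g) + ((B - A) * l)%:E
     <= \esum_(g in setT) ((p g)%:E * f g))%E.
Proof.
move=> alp l0 lf sA sB.
have al0 g : (0 <= (al g)%:E)%E by rewrite lee_fin; case/andP: (alp g).
have d0 g : (0 <= (p g - al g)%:E)%E by rewrite lee_fin subr_ge0; case/andP: (alp g).
have f0 g : (0 <= f g)%E by apply: le_trans (lf g); rewrite lee_fin.
have -> : (\esum_(g in setT) ((p g)%:E * f g) = \esum_(g in setT) ((al g)%:E * f g)
    + \esum_(g in setT) ((p g - al g)%:E * f g))%E.
  rewrite -esumD => [|g _|g _]; rewrite ?mule_ge0//.
  apply: eq_esum => g _; rewrite -ge0_muleDl// -EFinD; congr (_%:E * _)%E; ring.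
rewrite leeD2l//.
have sd : (\esum_(g in setT) (p g - al g)%:E = (B - A)%:E)%E.
  have : (A%:E + \esum_(g in setT) (p g - al g)%:E = B%:E)%E.
    rewrite -sA -sB -esumD//; apply: eq_esum => g _.
    by rewrite -EFinD; congr EFin; ring.
  case: (\esum_(_ in _) _)%E => //= r; rewrite -EFinD => -[<-]; congr EFin; ring.
rewrite mulrC EFinM -sd -esumZl//; apply: le_esum => g _.
by rewrite muleC lee_wpmul2l.
Qed.

(** Away from [g] the sum of [p] is finite and dominates that of [al], so it cancels and the whole
    deficit [d] is charged to [g]. *)
Lemma esum_pinch (p al : T -> \bar R) (c d : R) g :
  (forall h, 0 <= al h <= p h)%E -> (\esum_(h in [set: T]) p h <= c%:E)%E ->
  (c%:E <= \esum_(h in [set: T]) al h + d%:E)%E -> (p g <= al g + d%:E)%E.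
Proof.
move=> alp.
have al0 h : (0 <= al h)%E by case/andP: (alp h).
have ap h : (al h <= p h)%E by case/andP: (alp h).
have p0 h : (0 <= p h)%E by apply: le_trans (ap h).
rewrite (esumID [set g] _ p)// (esumID [set g] _ al)// !setTI !esum_set1//.
set r := esum _ p; set r' := esum _ al => pc cal.
have rr' : (r' <= r)%E by apply: le_esum.
have r0 : (0 <= r)%E by apply: esum_ge0.
have rfin : r \is a fin_num.
  rewrite ge0_fin_numE// (@le_lt_trans _ _ c%:E) ?ltry//.
  by apply: le_trans pc; rewrite leeDr.
rewrite -(leeD2rE _ _ rfin); apply: le_trans pc _; apply: le_trans cal _.
by rewrite addeAC leeD2l.
Qed.

End esum_lemmas.

Lemma esum_swap (R : realType) (T1 T2 : choiceType) (a : T1 -> T2 -> \bar R) :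
  (forall i j, 0 <= a i j)%E ->
  (\esum_(i in [set: T1]) \esum_(j in [set: T2]) a i j =
   \esum_(j in [set: T2]) \esum_(i in [set: T1]) a i j)%E.
Proof.
move=> a0; rewrite !esum_esum//.
apply: (@reindex_esum _ _ _ _ _ (fun k : T2 * T1 => (k.2, k.1))); split.
- by move=> [i j].
- by move=> [i j] [k l] _ _ /= [-> ->].
- by move=> [i j] _; exists (j, i).
Qed.

Section rsum_lemmas.
Variables (R : realType) (T : choiceType) (D : set T).

Lemma rsumN (F : T -> R) : rsum D (fun x => - F x) = - rsum D F.
Proof.
rewrite /rsum opprB; congr (fine _ - fine _).
by apply: eq_esum => x _; rewrite /funrneg opprK.
Qed.

(** Adding [M * K] makes the family nonnegative, so that a signed [rsum] can be handled through
    [esum]. *)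
Lemma rsum_shift (F K : T -> R) (M : R) : 0 <= M ->
  (forall x, 0 <= K x) -> (forall x, `|F x| <= M * K x) ->
  (\esum_(x in D) (K x)%:E = 1)%E ->
  (\esum_(x in D) (F x + M * K x)%:E = (rsum D F + M)%:E)%E.
Proof.
move=> M0 K0 FK K1.
have MK : (\esum_(x in D) (M * K x)%:E = M%:E)%E.
  by under eq_esum do rewrite EFinM; rewrite esumZl ?K1 ?mule1.
have fin (H : T -> R) : (forall x, 0 <= H x <= M * K x) ->
    ((fine (\esum_(x in D) (H x)%:E))%:E = \esum_(x in D) (H x)%:E)%E.
  move=> HM; rewrite fineK// ge0_fin_numE; last first.
    by apply: esum_ge0 => x _; rewrite lee_fin; case/andP: (HM x).
  apply: (@le_lt_trans _ _ M%:E); last exact: ltry.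
  by rewrite -MK; apply: le_esum => x _; rewrite lee_fin; case/andP: (HM x).
have Fp x : 0 <= F^\+ x <= M * K x.
  by rewrite funrpos_ge0 /funrpos ge_max mulr_ge0// andbT (le_trans (ler_norm _)).
have Fn x : 0 <= F^\- x <= M * K x.
  by rewrite funrneg_ge0 /funrneg ge_max mulr_ge0// andbT (le_trans (ler_norm _))// normrN.
have FB x : F^\+ x - F^\- x = F x by rewrite -[RHS](congr1 (@^~ x) (funrposBneg F)).
have : (\esum_(x in D) (F x + M * K x)%:E + \esum_(x in D) (F^\- x)%:E
     = \esum_(x in D) (F^\+ x)%:E + M%:E)%E.
  rewrite -MK -!esumD => [|x _|x _|x _|x _]; rewrite ?lee_fin ?funrneg_ge0 ?funrpos_ge0 ?mulr_ge0//.
    by apply: eq_esum => x _; rewrite -!EFinD -(FB x); congr EFin; ring.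
  by have := FK x; rewrite ler_norml; lra.
rewrite /rsum -(fin _ Fp) -(fin _ Fn).
set a := fine _; set b := fine _.
case: (\esum_(_ in _) (_ + _)%:E)%E => //= r; rewrite -!EFinD => -[rE].
by congr EFin; lra.
Qed.

End rsum_lemmas.

(** * Lower bounds from partial knowledge of the past *)

Section histories.
Variable G : Type.
Implicit Types (s : seq G) (z : nat -> G).

Lemma prepend_nil z : prepend [::] z = z.
Proof. by apply/funext => k; rewrite /prepend nth_nil subn0. Qed.

Lemma prepend_lt x0 s z k : (k < size s)%N -> prepend s z k = nth x0 s k.
Proof. by move=> ks; apply: set_nth_default. Qed.

Lemma prepend_ge s z k : (size s <= k)%N -> prepend s z k = z (k - size s)%N.
Proof. by move=> sk; rewrite /prepend nth_default. Qed.

Lemma prepend_cons g s z : prepend (g :: s) z = prepend [:: g] (prepend s z).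
Proof.
by apply/funext => -[|k]; rewrite /prepend//= nth_nil subn1/= subSS.
Qed.

Lemma prepend_take k s z : prepend s z =
  prepend (take k s) (fun j => prepend s z (j + size (take k s))%N).
Proof.
apply/funext => j; case: (ltnP j (size (take k s))) => h; last first.
  by rewrite [RHS]prepend_ge// subnK.
have js : (j < size s)%N by apply: leq_trans h _; rewrite size_take_min geq_minr.
have jk : (j < k)%N by apply: leq_trans h _; rewrite size_take_min geq_minl.
by rewrite (prepend_lt (z 0%N) z js) (prepend_lt (z 0%N) _ h) nth_take.
Qed.

Lemma prepend_mkseq k z : prepend (mkseq z k) (fun j => z (j + k)%N) = z.
Proof.
apply/funext => j; case: (ltnP j k) => jk.
  by rewrite (prepend_lt (z 0%N)) ?size_mkseq// nth_mkseq.
by rewrite prepend_ge ?size_mkseq// subnK.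
Qed.

Lemma mkseq_prepend s z : mkseq (prepend s z) (size s) = s.
Proof.
apply: (@eq_from_nth _ (z 0%N)); rewrite ?size_mkseq// => i ils.
by rewrite nth_mkseq// (prepend_lt (z 0%N)).
Qed.

Lemma take_mkseq l k z : (l <= k)%N -> take l (mkseq z k) = mkseq z l.
Proof.
move=> lk; apply: (@eq_from_nth _ (z 0%N)).
  by rewrite size_takel !size_mkseq.
by move=> i; rewrite size_takel ?size_mkseq// => il;
  rewrite nth_take// !nth_mkseq//; apply: leq_trans lk.
Qed.

End histories.

Section kernel.
Variables (R : realType) (G : pointedType) (P : G -> (nat -> G) -> R).
Hypothesis P_ge0 : forall g w, 0 <= P g w.
Hypothesis P_sum : forall w, (\esum_(g in [set: G]) (P g w)%:E = 1)%E.
Implicit Types (s : seq G) (g : G) (z : nat -> G).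

Lemma a_word_ge0 s g : 0 <= a_word P s g.
Proof.
apply: lb_le_inf; first by exists (P g (prepend s (fun=> point))), (fun=> point).
by move=> _ [z _ <-].
Qed.

Lemma a_word_le s g z : a_word P s g <= P g (prepend s z).
Proof. by apply: ge_inf; [exists 0 => _ [y _ <-]|exists z]. Qed.

Lemma a_word_take k s g : a_word P (take k s) g <= a_word P s g.
Proof.
apply: lb_le_inf; first by exists (P g (prepend s (fun=> point))), (fun=> point).
by move=> _ [z _ <-]; rewrite (prepend_take k); exact: a_word_le.
Qed.

Definition a_sum s : R := fine (\esum_(g in [set: G]) (a_word P s g)%:E).

Lemma a_sumE s : (\esum_(g in [set: G]) (a_word P s g)%:E = (a_sum s)%:E)%E.
Proof.
rewrite /a_sum fineK// ge0_fin_numE; last first.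
  by apply: esum_ge0 => g _; rewrite lee_fin a_word_ge0.
apply: (@le_lt_trans _ _ 1%E); last exact: ltry.
rewrite -(P_sum (prepend s (fun=> point))); apply: le_esum => g _.
by rewrite lee_fin a_word_le.
Qed.

Lemma a_sum01 s : 0 <= a_sum s <= 1.
Proof.
rewrite -!lee_fin -a_sumE; apply/andP; split.
  by apply: esum_ge0 => g _; rewrite lee_fin a_word_ge0.
rewrite -(P_sum (prepend s (fun=> point))); apply: le_esum => g _.
by rewrite lee_fin a_word_le.
Qed.

Lemma a_sum_take k s : a_sum (take k s) <= a_sum s.
Proof.
by rewrite -lee_fin -!a_sumE; apply: le_esum => g _; rewrite lee_fin a_word_take.
Qed.

Lemma a_num_le s : a_num P (size s) <= a_sum s.
Proof.
by apply: ge_inf; [exists 0 => _ [r _ <-]; case/andP: (a_sum01 r)|exists s].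
Qed.

Let a_num_nonempty k :
  nonempty [set fine (\esum_(g in [set: G]) (a_word P s g)%:E) |
        s in [set s : seq G | size s = k]].
Proof. by exists (a_sum (nseq k point)), (nseq k point); rewrite //= size_nseq. Qed.

Lemma a_num01 k : 0 <= a_num P k <= 1.
Proof.
apply/andP; split.
  by apply: (lb_le_inf (a_num_nonempty k)) => _ [s _ <-]; case/andP: (a_sum01 s).
by have := a_num_le (nseq k point); rewrite size_nseq => /le_trans; apply;
  case/andP: (a_sum01 (nseq k point)).
Qed.

Lemma a_num_nd : {homo a_num P : k l / (k <= l)%N >-> k <= l}.
Proof.
move=> k l kl; apply: (lb_le_inf (a_num_nonempty l)) => _ [s /= sl <-].
apply: le_trans (a_sum_take k s).
by have := a_num_le (take k s); rewrite size_takel// sl.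
Qed.

Section lower_functional.
Variables (phi : (nat -> G) -> R) (L : nat).
Hypothesis phi_ge0 : forall z, 0 <= phi z.
Hypothesis phi_dep : forall y z, (forall k, (k < L)%N -> y k = z k) -> phi y = phi z.

(* A lower bound for the expectation of [phi] after [n] steps when only the
   letters in [s] are known: the next letter is [g] and stays known with
   probability at least [a_word P s g], and the remaining mass starts again from
   no knowledge at all. *)
Fixpoint low (n : nat) (s : seq G) : \bar R :=
  if n is m.+1 then
    (\esum_(g in [set: G]) ((a_word P s g)%:E * low m (g :: s))
     + (1 - a_sum s)%:E * low m [::])%E
  else if (L <= size s)%N then (phi (prepend s (fun=> point)))%:E else 0%E.

Lemma low_ge0 n s : (0 <= low n s)%E.
Proof.
elim: n s => [|n IH] s /=; first by case: ifP; rewrite ?lee_fin.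
have /andP[a0 a1] := a_sum01 s.
rewrite adde_ge0// ?mule_ge0// ?lee_fin ?subr_ge0//; apply: esum_ge0 => g _.
by rewrite mule_ge0// lee_fin a_word_ge0.
Qed.

Hypothesis phi_bnd : exists M, forall z, phi z <= M.

Lemma low_bnd : exists M, forall n s, (low n s <= M%:E)%E.
Proof.
have [M phiM] := phi_bnd; exists M.
have M0 : 0 <= M := le_trans (phi_ge0 (fun=> point)) (phiM _).
elim=> [|n IH] s /=; first by case: ifP; rewrite lee_fin.
have /andP[a0 a1] := a_sum01 s.
have -> : M%:E = ((a_sum s)%:E * M%:E + (1 - a_sum s)%:E * M%:E)%E.
  by rewrite -!EFinM -EFinD; congr EFin; ring.
rewrite leeD// ?lee_wpmul2l ?lee_fin ?subr_ge0//.
rewrite muleC -a_sumE -esumZl// => [|g]; last by rewrite lee_fin a_word_ge0.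
by apply: le_esum => g _; rewrite muleC lee_wpmul2r// lee_fin a_word_ge0.
Qed.

Definition rlow n s := fine (low n s).

Lemma rlowE n s : (rlow n s)%:E = low n s.
Proof.
have [M lM] := low_bnd; rewrite fineK// ge0_fin_numE ?low_ge0//.
by apply: le_lt_trans (lM _ _) _; rewrite ltry.
Qed.

Lemma rlow_ge0 n s : 0 <= rlow n s.
Proof. by rewrite -lee_fin rlowE low_ge0. Qed.

(** More known letters give a larger [a_word]; the mass gained continues from [g :: s] instead of
    restarting from [[::]], which by induction does not lower the bound. *)
Lemma low_take n k s : (low n (take k s) <= low n s)%E.
Proof.
elim: n k s => [|n IH] k s /=.
  case: ifP => [Lk|_]; last by case: ifP; rewrite ?lee_fin.
  rewrite (leq_trans Lk) ?size_take_min ?geq_minr// lee_fin.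
  rewrite (@phi_dep _ (prepend s (fun=> point)))// => j jL.
  rewrite [in RHS](prepend_take k) !(prepend_lt point)//; exact: leq_trans Lk.
have l0 r : (low n [::] <= low n r)%E by rewrite -(take0 r) IH.
have amix : (\esum_(g in setT) ((a_word P (take k s) g)%:E * low n (g :: s))
    + ((a_sum s - a_sum (take k s)) * rlow n [::])%:E
   <= \esum_(g in setT) ((a_word P s g)%:E * low n (g :: s)))%E.
  apply: esum_mix; rewrite ?a_sumE ?rlow_ge0// => g; last by rewrite rlowE.
  by rewrite a_word_ge0 a_word_take.
rewrite -(rlowE n [::]) -!EFinM.
apply: le_trans (leeD amix (lexx ((1 - a_sum s) * rlow n [::])%:E)).
rewrite -addeA -EFinD; apply: leeD; last by rewrite lee_fin; lra.
by apply: le_esum => g _; rewrite lee_wpmul2l ?lee_fin ?a_word_ge0// (IH k.+1 (g :: s)).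
Qed.

Lemma low_nil n s : (low n [::] <= low n s)%E.
Proof. by rewrite -(take0 s) low_take. Qed.

(** The weights [p] are general because they serve twice: as a kernel with [m = 1], and as the
    masses of the pieces of an event split by its next letter. Their excess over [m * a_word P s] is
    worth at least [low n [::]] per unit of mass. *)
Lemma low_step (p : G -> R) m n s : 0 <= m ->
  (forall g, m * a_word P s g <= p g) -> (\esum_(g in setT) (p g)%:E = m%:E)%E ->
  (m%:E * low n.+1 s <= \esum_(g in setT) ((p g)%:E * low n (g :: s)))%E.
Proof.
move=> m0 mp sp; rewrite /= ge0_muleDr; last 2 first.
- by apply: esum_ge0 => g _; rewrite mule_ge0 ?low_ge0 ?lee_fin ?a_word_ge0.
- by rewrite mule_ge0 ?low_ge0 ?lee_fin ?subr_ge0//; case/andP: (a_sum01 s).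
have al0 g : 0 <= m * a_word P s g <= p g by rewrite mp mulr_ge0 ?a_word_ge0.
have sal : (\esum_(g in [set: G]) (m * a_word P s g)%:E = (m * a_sum s)%:E)%E.
  under eq_esum do rewrite EFinM.
  by rewrite esumZl ?a_sumE// => g; rewrite lee_fin a_word_ge0.
have ll g : ((rlow n [::])%:E <= low n (g :: s))%E by rewrite rlowE low_nil.
apply: le_trans (esum_mix al0 (rlow_ge0 _ _) ll sal sp).
under [in leRHS]eq_esum do rewrite EFinM -muleA.
rewrite esumZl// => [|g]; last by rewrite mule_ge0 ?low_ge0 ?lee_fin ?a_word_ge0.
by rewrite leeD2l// -(rlowE n [::]) -!EFinM lee_fin; lra.
Qed.

Fixpoint expect (n : nat) (z : nat -> G) : \bar R :=
  if n is m.+1 then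
    (\esum_(g in [set: G]) ((P g z)%:E * expect m (prepend [:: g] z)))%E
  else (phi z)%:E.

Lemma low_expect n s z : (low n s <= expect n (prepend s z))%E.
Proof.
elim: n s => [|n IH] s.
  rewrite /=; case: ifP => Ls; rewrite lee_fin//.
  rewrite (@phi_dep _ (prepend s z))// => j jL.
  by rewrite !(prepend_lt point)//; exact: leq_trans Ls.
rewrite -[leLHS]mul1e.
apply: le_trans (@low_step (P ^~ (prepend s z)) 1 n s ler01 _ (P_sum _)) _.
  by move=> g; rewrite mul1r a_word_le.
by apply: le_esum => g _; rewrite lee_wpmul2l ?lee_fin// -prepend_cons IH.
Qed.

End lower_functional.

(* Probability that the house-of-cards chain started at [k] is below [L] at
   time [n], i.e. that [low] has lost track of one of the last [L] letters. *)
Definition forget L n k := iter n (hoc_op (a_num P)) (fun k => (k < L)%:R) k.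

Lemma forget_noninc L n : {homo forget L n : k l / (k <= l)%N >-> l <= k}.
Proof.
apply: iter_hoc_noninc a_num01 a_num_nd _ _ _ => k l kl.
by rewrite ler_nat; case: (ltnP l L) => // lL; rewrite (leq_ltn_trans kl lL).
Qed.

(** At time 0 the two bounds together miss nothing if [L] letters are known and everything
    otherwise; the recursion carries this loss along the chain. *)
Lemma low_add (phi psi : (nat -> G) -> R) L c n s :
  (forall z, 0 <= phi z) -> (forall z, 0 <= psi z) ->
  (forall z, phi z + psi z = c) -> 0 <= c ->
  ((c * (1 - forget L n (size s)))%:E <= low phi L n s + low psi L n s)%E.
Proof.
move=> phi0 psi0 phipsi c0; elim: n s => [|n IH] s.
  rewrite /forget /=; case: leqP => Ls.
    by rewrite lee_fin phipsi subr0 mulr1.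
  by rewrite adde0 subrr mulr0.
have /andP[A0 A1] := a_sum01 s.
have -> : forget L n.+1 (size s) = a_num P (size s) * forget L n (size s).+1
  + (1 - a_num P (size s)) * forget L n 0 by [].
rewrite /= addeACA -ge0_muleDr ?low_ge0// -esumD; last 2 first.
- by move=> g _; rewrite mule_ge0 ?low_ge0 ?lee_fin ?a_word_ge0.
- by move=> g _; rewrite mule_ge0 ?low_ge0 ?lee_fin ?a_word_ge0.
set x := c * (1 - forget L n (size s).+1); set y := c * (1 - forget L n 0).
have yx : y <= x by rewrite ler_wpM2l// lerB// forget_noninc.
(* The larger weight [a_sum s] may replace [a_num P (size s)] because [y <= x]: a chain that starts
   higher forgets less. *)
apply: (@le_trans _ _ (a_sum s * x + (1 - a_sum s) * y)%:E).
  rewrite lee_fin; have := a_num_le s; rewrite {}/x {}/y in yx *; nra.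
rewrite EFinD; apply: leeD; last first.
  by rewrite EFinM lee_wpmul2l ?lee_fin ?subr_ge0//; exact: (IH [::]).
have x0 : 0 <= x.
  rewrite mulr_ge0// subr_ge0 /forget -[leRHS](iter_hoc_cst (a_num P) n 1 (size s).+1).
  by apply: (iter_hoc_le a_num01) => k /=; case: (k < L)%N; rewrite ?lexx ?ler01.
rewrite mulrC EFinM -a_sumE -esumZl// => [|g]; last by rewrite lee_fin a_word_ge0.
apply: le_esum => g _; rewrite -ge0_muleDr ?low_ge0//.
rewrite muleC lee_wpmul2l ?lee_fin ?a_word_ge0//.
exact: IH (g :: s).
Qed.

End kernel.

(** * Loss of memory *)

Section conditional_expectation.
Variables (R : realType) (G : pointedType) (P : G -> (nat -> G) -> R).
Hypothesis P_ge0 : forall g w, 0 <= P g w.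
Hypothesis P_sum : forall w, (\esum_(g in [set: G]) (P g w)%:E = 1)%E.

Lemma past_glue (i : int) (r : seq G) (w : int -> G) : past i (Defs.glue i r w) = past i w.
Proof.
apply/funext => k; rewrite /past /Defs.glue ifT//; lia.
Qed.

Lemma glue_nil (i : int) (w : int -> G) : Defs.glue i [::] w = w.
Proof. by apply/funext => j; rewrite /Defs.glue nth_nil; case: ifP. Qed.

Lemma glue_cons (i : int) g r (w : int -> G) :
  Defs.glue i (g :: r) w = Defs.glue (i + 1) r (Defs.glue i [:: g] w).
Proof.
apply/funext => j; rewrite /Defs.glue.
have [ji|ij|->] := ltgtP j i.
- by rewrite ifT//; lia.
- rewrite ifF; last lia.
  have -> : `|j - i|%N = `|j - (i + 1)%R|%N.+1 by lia.
  by rewrite /= nth_nil.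
- by rewrite ifT ?subrr//; lia.
Qed.

Lemma past_glue1 (i : int) g (w : int -> G) :
  past (i + 1) (Defs.glue i [:: g] w) = prepend [:: g] (past i w).
Proof.
apply/funext => -[|k]; rewrite /past /prepend /=.
  by rewrite addrK /Defs.glue ltxx subrr.
have -> : i + 1 - k.+2%:Z = i - k.+1%:Z by lia.
rewrite nth_nil subn1/= /Defs.glue ifT//; lia.
Qed.

Definition word_prob (i : int) (r : seq G) (w : int -> G) : R :=
  \prod_(k < size r) P (Defs.glue i r w (i + k%:Z)) (past (i + k%:Z) (Defs.glue i r w)).

Lemma word_prob_cons i g r w : word_prob i (g :: r) w =
  P g (past i w) * word_prob (i + 1) r (Defs.glue i [:: g] w).
Proof.
rewrite /word_prob big_ord_recl/= addr0 past_glue {1}/Defs.glue ltxx subrr/=.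
congr (_ * _); apply: eq_bigr => k _; rewrite -glue_cons.
by have -> : i + (bump 0 k)%:Z = i + 1 + k%:Z by rewrite /bump; lia.
Qed.

Lemma word_prob_ge0 i r w : 0 <= word_prob i r w.
Proof. exact: prodr_ge0. Qed.

Lemma esum_words (n : nat) (F : seq G -> \bar R) : (forall r, 0 <= F r)%E ->
  (\esum_(r in [set r : seq G | size r = n.+1]) F r =
   \esum_(g in [set: G]) \esum_(r in [set r : seq G | size r = n]) F (g :: r))%E.
Proof.
move=> F0; rewrite esum_esum//.
apply: (@reindex_esum _ _ _ _ _ (fun k : G * seq G => k.1 :: k.2)); split.
- by move=> [g r] /= [_ ->].
- by move=> [g r] [h q] _ _ /= [-> ->].
- by move=> [//|g r] /= [rn]; exists (g, r).
Qed.

(** Induction on the first letter of the word: the sum over the other letters is the expectation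
    from the past extended by that letter. *)
Lemma expect_words (psi : (nat -> G) -> R) n i w : (forall z, 0 <= psi z) ->
  (\esum_(r in [set r : seq G | size r = n])
     (psi (past (i + n%:Z) (Defs.glue i r w)) * word_prob i r w)%:E
   = expect P psi n (past i w))%E.
Proof.
move=> psi0; elim: n i w => [|n IH] i w.
  have -> : [set r : seq G | size r = 0%N] = [set [::]].
    by apply/seteqP; split => [[]|_ ->].
  rewrite esum_set1; last by rewrite lee_fin mulr_ge0 ?word_prob_ge0.
  by rewrite /word_prob /= big_ord0 mulr1 addr0 glue_nil.
rewrite esum_words => [|r]; last by rewrite lee_fin mulr_ge0 ?word_prob_ge0.
rewrite [RHS]/=; apply: eq_esum => g _; rewrite -past_glue1 -IH -esumZl => [|//|r]; last first.
  by rewrite lee_fin mulr_ge0 ?word_prob_ge0.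
apply: eq_esum => r _; rewrite -EFinM word_prob_cons -glue_cons.
have -> : i + 1 + n%:Z = i + n.+1%:Z by lia.
by congr EFin; ring.
Qed.

Lemma expect_cst c n z : 0 <= c -> expect P (fun=> c) n z = c%:E.
Proof.
move=> c0; elim: n z => //= n IH z.
under eq_esum do rewrite IH muleC.
by rewrite esumZl ?P_sum ?mule1// => g; rewrite lee_fin.
Qed.

(** The shift by [M] makes [f] nonnegative, and [f] is read as a function of the past of time
    [t + 1]. *)
Lemma expect_shift (f : (int -> G) -> R) (M : R) (s t i : int) w : 0 <= M ->
  (forall x, `|f x| <= M) -> i <= t -> depends_on s t f ->
  expect P (fun z => f (fun j => z `|t - j|%N) + M) `|t - i|.+1 (past i w)
  = (cond_exp P i t f w + M)%:E.
Proof.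
move=> M0 fM it f_dep; pose n := `|t - i|%N.+1.
have fM0 x : 0 <= f x + M by have := fM x; rewrite ler_norml; lra.
(* Position [k] of the past of time [t + 1] is the coordinate [t - k]. For [j > t] the formula reads
   another coordinate, but [f] looks only at [[s, t]]. *)
have f_past x : f (fun j => past (i + n%:Z) x `|t - j|%N) = f x.
  by apply: f_dep => j /andP[sj jt]; rewrite /past /n; congr (x _); lia.
rewrite -expect_words//.
rewrite -[cond_exp P i t f w]/(rsum [set r : seq G | size r = n]
  (fun r => f (Defs.glue i r w) * word_prob i r w)).
rewrite -(@rsum_shift _ _ _ _ (fun r => word_prob i r w))//.
- by apply: eq_esum => r _; rewrite f_past mulrDl.
- by move=> r; exact: word_prob_ge0.
- by move=> r; rewrite normrM (ger0_norm (word_prob_ge0 _ _ _)) ler_wpM2r ?word_prob_ge0.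
(* The word probabilities sum to 1, being the expectation of the constant 1. *)
- rewrite -(@expect_cst 1 n (past i w) ler01) -expect_words//.
  by apply: eq_esum => r _; rewrite mul1r.
Qed.

Lemma cond_expN (i t : int) (f : (int -> G) -> R) w :
  cond_exp P i t (fun x => - f x) w = - cond_exp P i t f w.
Proof.
rewrite /cond_exp -rsumN; congr rsum; apply/funext => r /=; exact: mulNr.
Qed.

Lemma rhoE m : rho P m = hoc_rho (a_num P) m.
Proof. by rewrite /rho chain_lawE. Qed.

(** The lower bounds for [f + M] and [M - f] are the same for all pasts and confine both conditional
    expectations to one interval of length at most [2 * M * forget P L n 0]. *)
Lemma loss_of_memory (f : (int -> G) -> R) (M : R) (s t i : int) w v :
  s <= t -> i <= s -> (forall x, `|f x| <= M) -> depends_on s t f ->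
  `|cond_exp P i t f w - cond_exp P i t f v| <=
    2 * M * \sum_(0 <= j < `|t - s|.+1) rho P (`|s - i| + j)%N.
Proof.
move=> st ls fM f_dep.
have it : i <= t by exact: le_trans st.
have M0 : 0 <= M by apply: le_trans (fM (fun=> point)).
have f_depN : depends_on s t (fun x => - f x).
  by move=> x y xy; rewrite (f_dep x y xy).
have fMN x : `|- f x| <= M by rewrite normrN.
pose phi z := f (fun j => z `|t - j|%N) + M.
pose psi z := - f (fun j => z `|t - j|%N) + M.
pose n := `|t - i|%N.+1; pose L := `|t - s|%N.+1.
have phi0 z : 0 <= phi z.
  by rewrite /phi; have := fM (fun j => z `|t - j|%N); rewrite ler_norml; lra.
have psi0 z : 0 <= psi z.
  by rewrite /psi; have := fM (fun j => z `|t - j|%N); rewrite ler_norml; lra.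
have dep (y z : nat -> G) : (forall k, (k < L)%N -> y k = z k) ->
    f (fun j => y `|t - j|%N) = f (fun j => z `|t - j|%N).
  by move=> yz; apply: f_dep => j /andP[sj jt]; apply: yz; rewrite /L; lia.
have phi_dep y z : (forall k, (k < L)%N -> y k = z k) -> phi y = phi z.
  by move=> /dep; rewrite /phi => ->.
have psi_dep y z : (forall k, (k < L)%N -> y k = z k) -> psi y = psi z.
  by move=> /dep; rewrite /psi => ->.
have phi_bnd : exists B, forall z, phi z <= B.
  exists (M + M) => z; rewrite /phi.
  by have := fM (fun j => z `|t - j|%N); rewrite ler_norml; lra.
have psi_bnd : exists B, forall z, psi z <= B.
  exists (M + M) => z; rewrite /psi.
  by have := fM (fun j => z `|t - j|%N); rewrite ler_norml; lra.
have lower x : rlow P phi L n [::] <= cond_exp P i t f x + M.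
  rewrite -lee_fin rlowE// -(@expect_shift _ _ s)//.
  by rewrite -(prepend_nil (past i x)); apply: low_expect.
have upper x : rlow P psi L n [::] <= - cond_exp P i t f x + M.
  rewrite -lee_fin rlowE// -cond_expN -(@expect_shift _ _ s)//.
  by rewrite -(prepend_nil (past i x)); apply: low_expect.
have := low_add P_ge0 P_sum L n [::] phi0 psi0 (c := 2 * M).
rewrite -!rlowE// -EFinD lee_fin => sum_ge.
have {}sum_ge : 2 * M * (1 - forget P L n 0) <= rlow P phi L n [::] + rlow P psi L n [::].
  by apply: sum_ge => [z|]; rewrite ?mulr_ge0// /phi /psi; ring.
have : forget P L n 0 <= \sum_(0 <= j < L) rho P (`|s - i| + j)%N.
  apply: le_trans (iter_hoc_below_le (a_num01 P_ge0 P_sum) n L) _.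
  (* After the reversal the term [j] is [rho] at time [s - i + j + 1]; monotonicity of [rho] absorbs
     the extra 1. *)
  rewrite big_mkord (reindex_inj rev_ord_inj); apply: ler_sum => j _.
  rewrite rhoE; apply: (hoc_rho_noninc (a_num01 P_ge0 P_sum) (a_num_nd P_ge0 P_sum)).
  by have := ltn_ord j; rewrite /= /n /L; lia.
move=> /(ler_wpM2l (mulr_ge0 (ler0n _ 2) M0)) le.
have := lower w; have := lower v; have := upper w; have := upper v.
rewrite ler_norml; lra.
Qed.

End conditional_expectation.

(** * Uniqueness *)

Section countable_labels.
Variables (I : choiceType) (rk : I -> nat).
Hypothesis rk_inj : injective rk.

Lemma countable_labels : countable [set: I].
Proof. by apply/countable_injP; exists rk => x y _ _ /rk_inj. Qed.

Lemma bigcup_label_measurable d (T : measurableType d) (D : set I) (F : I -> set T) :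
  (forall i, D i -> measurable (F i)) -> measurable (\bigcup_(i in D) F i).
Proof.
move=> mF; rewrite bigcup_mkcond; apply: countable_bigcupT_measurable.
  exact: countable_labels.
by move=> i; case: ifP => // /set_mem /mF.
Qed.

Lemma measure_label_bigcup d (T : measurableType d) (R : realType)
    (mu : {measure set T -> \bar R}) (F : I -> set T) :
  (forall i, measurable (F i)) -> trivIset setT F ->
  (mu (\bigcup_i F i) = \esum_(i in [set: I]) mu (F i))%E.
Proof.
move=> mF tF; pose H n := \bigcup_(i in [set i | rk i = n]) F i.
have HE i : H (rk i) = F i.
  apply/seteqP; split => [x [j /= /rk_inj <-]//|x Fx].
  by exists i.
have -> : \bigcup_i F i = \bigcup_(n in range rk) H n.
  apply/seteqP; split => [x [i _ Fx]|x [n _ [i _ Fx]]]; last by exists i.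
  by exists (rk i); [exists i|rewrite HE].
rewrite measure_bigcup.
- rewrite nneseries_esum// (_ : [set x | x \in range rk] = range rk).
    by rewrite esum_image => [|i j _ _ /rk_inj//]; apply: eq_esum => i _; rewrite /= HE.
  by apply/seteqP; split => x /=; rewrite inE.
- by move=> _ [i _ <-]; rewrite HE.
- by move=> _ _ [i _ <-] [j _ <-]; rewrite !HE => /(tF i j Logic.I Logic.I) ->.
Qed.

End countable_labels.

(** * Measurability on path spaces *)

Section paths_measurability.
Variables (G : pointedType).

Lemma measurable_coord (I : Type) (i : I) (A : set G) :
  measurable [set x : paths I G | A (x i)].
Proof. by apply: sub_sigma_algebra; exists i, A. Qed.

Lemma measurable_past i : measurable_fun [set: paths int G] (past i : paths int G -> paths nat G).
Proof.
apply: (measurability (@cylinders nat G : set (set (paths nat G)))) => //.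
move=> _ [_ [k [A ->]] <-]; rewrite setTI; exact: (measurable_coord (i - k.+1%:Z) A).
Qed.

Lemma measurable_to_paths d (T : measurableType d) (I : Type) (X : T -> paths I G)
    (rk : G -> nat) : injective rk ->
  (forall i g, measurable [set x | X x i = g]) -> measurable_fun [set: T] X.
Proof.
move=> rk_inj mX; apply: (measurability (@cylinders I G : set (set (paths I G)))) => //.
move=> _ [_ [k [A ->]] <-]; rewrite setTI.
rewrite (_ : _ @^-1` _ = \bigcup_(g in A) [set x | X x k = g]).
  exact: bigcup_label_measurable rk_inj _ _ _ _ _.
by apply/seteqP; split => [x Ax|x [g Ag /= XE]]; [exists (X x k)|rewrite /preimage/= XE].
Qed.

Lemma measurable_mkseq k (s : seq G) : measurable [set h : paths nat G | mkseq h k = s].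
Proof.
case: (eqVneq (size s) k) => sk; last first.
  rewrite (_ : [set _ | _] = set0)//; apply/seteqP; split => // h /= hs.
  by rewrite -hs size_mkseq eqxx in sk.
rewrite (_ : [set _ | _] = \bigcap_(j in `I_k) [set h : paths nat G | h j = nth point s j]).
  by apply: bigcap_measurableType => j _; exact: (measurable_coord j [set nth point s j]).
apply/seteqP; split => h /= hs.
  by move=> j /= jk; rewrite -hs nth_mkseq.
apply: (@eq_from_nth _ point); rewrite size_mkseq// => j jk.
by rewrite nth_mkseq// hs.
Qed.

End paths_measurability.

(** * Measures satisfying the lower bounds, and their uniqueness *)

Section lower_compatibility.
Variables (R : realType) (G : pointedType) (rk : G -> nat).
Hypothesis rk_inj : injective rk.
Variable P : G -> (nat -> G) -> R.
Hypothesis P_ge0 : forall g w, 0 <= P g w.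
Hypothesis P_sum : forall w, (\esum_(g in [set: G]) (P g w)%:E = 1)%E.
Hypothesis P_meas : forall g, measurable_fun [set: paths nat G] (P g : paths nat G -> R).

Definition starts_with (s : seq G) (C : set (nat -> G)) : Prop :=
  forall h, C h -> mkseq h (size s) = s.

(* What compatibility says about the infima [a_word] alone; it suffices for
   uniqueness, and is equivalent to compatibility when [a_num P k] tends to 1. *)
Definition lower_compatible (nu : probability (paths int G) R) : Prop :=
  forall (i : int) (g : G) (s : seq G) (C : set (paths nat G)),
    measurable C -> starts_with s C ->
    ((a_word P s g)%:E * nu (past i @^-1` C)
      <= nu ([set x : paths int G | x i = g] `&` past i @^-1` C))%E.

Lemma measurable_past_preim i (C : set (paths nat G)) :
  measurable C -> measurable (past i @^-1` C : set (paths int G)).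
Proof.
by move=> mC; rewrite -[X in measurable X]setTI; exact: measurable_past.
Qed.

Lemma kernel_past_measurable i g :
  measurable_fun [set: paths int G] (EFin \o (fun x : paths int G => P g (past i x) : R)).
Proof.
apply/measurable_EFinP; exact: (measurableT_comp (P_meas g) (@measurable_past G i)).
Qed.

Lemma a_word_starts s g z : mkseq z (size s) = s -> a_word P s g <= P g z.
Proof.
by move=> zs; rewrite -[in leRHS](prepend_mkseq (size s) z) zs a_word_le.
Qed.

Lemma compatible_lower nu : compatible P nu -> lower_compatible nu.
Proof.
move=> compat i g s C mC sC; rewrite compat//.
have mE := measurable_past_preim i mC.
rewrite -integral_cst//; apply: ge0_le_integral => //.
- by move=> x _; rewrite lee_fin a_word_ge0.
- by apply: measurable_funTS; exact: kernel_past_measurable.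
- by move=> x Cx; rewrite lee_fin a_word_starts// sC.
Qed.

Section lower_bounds.
Variable nu : probability (paths int G) R.
Hypothesis nu_lower : lower_compatible nu.

Lemma measure_split_coord (E : set (paths int G)) i : measurable E ->
  (nu E = \esum_(g in [set: G]) nu ([set x : paths int G | x i = g] `&` E))%E.
Proof.
move=> mE; rewrite -(measure_label_bigcup rk_inj nu).
- congr (nu _); apply/seteqP; split => [x Ex|x [g _ []]//]; by exists (x i).
- by move=> g; apply: measurableI => //; exact: (measurable_coord i [set g]).
- by move=> g h _ _ [x [[/= <- _] [/= <- _]]].
Qed.

Section window.
Variables (E : set (paths int G)) (s t : int).
Hypotheses (mE : measurable E) (st : s <= t).
Hypothesis E_dep : forall x y : int -> G, (forall j, s <= j <= t -> x j = y j) -> E x -> E y.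

Let L := `|t - s|%N.+1.

(* The indicator of [E] as a function of the past of time [t + 1]. *)
Definition window_indic (E : set (int -> G)) (t : int) (z : nat -> G) : R :=
  (`[< E (fun j => z `|t - j|%N) >])%:R.

Lemma window_indic_dep (y z : nat -> G) :
  (forall k, (k < L)%N -> y k = z k) -> window_indic E t y = window_indic E t z.
Proof.
move=> yz; rewrite /window_indic; congr (nat_of_bool _)%:R; apply: asbool_equiv_eq.
by split; apply: E_dep => j /andP[sj jt]; rewrite yz// /L; lia.
Qed.

(** The analogue of [low_expect] for a measure, by induction on the number of letters from [i] to
    [t]: splitting by the letter at [i] gives events on the past of [i + 1] for which the word
    [g :: r] is known. *)
Lemma low_le_measure n (i : int) (r : seq G) (C : set (paths nat G)) :
  i + n%:Z = t + 1 -> measurable C -> starts_with r C ->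
  (nu (past i @^-1` C) * low P (window_indic E t) L n r
    <= nu (E `&` past i @^-1` C))%E.
Proof.
have fin_nu A : measurable A -> (fine (nu A))%:E = nu A.
  by move=> mA; rewrite fineK// fin_num_measure.
elim: n i r C => [|n IH] i r C it mC rC.
  (* Here [i = t + 1], so a word of length at least [L] covers the window and decides whether [E]
     holds. *)
  rewrite /=; case: ifP => [Lr|_]; last by rewrite mule0.
  have {}it : i = t + 1 by rewrite -it addr0.
  rewrite {1}/window_indic; case: asboolP => Er; last by rewrite mule0.
  rewrite mule1 (_ : E `&` _ = past i @^-1` C)//.
  apply/seteqP; split => [x []//|x Cx]; split => //.
  apply: (E_dep _ Er) => j /andP[sj jt].
  rewrite (prepend_lt point); last by move: Lr; rewrite /L; lia.
  have /rC <- := Cx; rewrite nth_mkseq; last by move: Lr; rewrite /L; lia.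
  by rewrite it /past; congr (x _); lia.
pose Cg g : set (paths nat G) := [set h | h 0%N = g] `&` [set h | C (fun k => h k.+1)].
have mCg g : measurable (Cg g).
  apply: measurableI; first exact: (measurable_coord 0%N [set g]).
  have tailm : measurable_fun [set: paths nat G] ((fun h k => h k.+1) : paths nat G -> paths nat G).
    apply: (measurability (@cylinders nat G : set (set (paths nat G)))) => //.
    move=> _ [_ [k [A ->]] <-]; rewrite setTI; exact: (measurable_coord k.+1 A).
  by rewrite -[X in measurable X]setTI; exact: tailm.
have CgE g : past (i + 1) @^-1` (Cg g) = [set x : paths int G | x i = g] `&` past i @^-1` C.
  have pS (x : int -> G) : (fun k => past (i + 1) x k.+1) = past i x.
    by apply/funext => k; rewrite /past; congr (x _); lia.
  have p0 (x : int -> G) : past (i + 1) x 0%N = x i by rewrite /past; congr (x _); lia.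
  by apply/seteqP; split => x; rewrite /preimage /Cg/= p0 pS.
have rCg g : starts_with (g :: r) (Cg g).
  move=> h [/= h0 /rC hr]; rewrite /mkseq/= h0 -[in RHS]hr; congr (_ :: _).
  by rewrite (iotaDl 1 0) -map_comp.
have mpast := measurable_past_preim i mC.
rewrite -fin_nu//; set m := fine _.
have m0 : 0 <= m by rewrite fine_ge0.
pose p g := fine (nu (past (i + 1) @^-1` (Cg g))).
have pE g : (p g)%:E = nu (past (i + 1) @^-1` (Cg g)).
  by rewrite fin_nu//; exact: measurable_past_preim.
have pa g : m * a_word P r g <= p g.
  by rewrite -lee_fin pE CgE EFinM fin_nu// muleC nu_lower.
have sp : (\esum_(g in [set: G]) (p g)%:E = m%:E)%E.
  rewrite fin_nu// (measure_split_coord i mpast).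
  by apply: eq_esum => g _; rewrite pE CgE.
have bnd : exists M, forall z, window_indic E t z <= M.
  by exists 1 => z; rewrite /window_indic; case: asbool.
have phi0 z : 0 <= window_indic E t z by rewrite ler0n.
apply: le_trans (low_step P_ge0 P_sum phi0 window_indic_dep bnd n m0 pa sp) _.
rewrite (measure_split_coord i (measurableI _ _ mE mpast)).
apply: le_esum => g _; rewrite pE setICA -CgE.
by apply: IH => //; lia.
Qed.

Lemma rlow_le_measure n :
  ((rlow P (window_indic E t) L n [::])%:E <= nu E)%E.
Proof.
have bnd : exists M, forall z, window_indic E t z <= M.
  by exists 1 => z; rewrite /window_indic; case: asbool.
have := @low_le_measure n (t + 1 - n%:Z) [::] setT _ measurableT _.
rewrite preimage_setT probability_setT mul1e setIT rlowE//; apply; first by rewrite subrK.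
by move=> h _.
Qed.

End window.
End lower_bounds.

Lemma forget_small L e : (\sum_(0 <= m <oo) (beta P m)%:E = +oo)%E -> 0 < e ->
  exists n, forget P L n 0 <= e.
Proof.
move=> beta_oo e0.
(* Dividing by [L.+1] rather than [L] includes the case [L = 0]. *)
have L0 : 0 < L.+1%:R :> R by rewrite ltr0n.
have [n rn] := hoc_rho_small (a_num01 P_ge0 P_sum) (a_num_nd P_ge0 P_sum) beta_oo (divr_gt0 e0 L0).
exists (n + L)%N; apply: le_trans (iter_hoc_below_le (a_num01 P_ge0 P_sum) (n + L) L) _.
apply: (@le_trans _ _ (\sum_(x < L) (e / L.+1%:R))).
  apply: ler_sum => x _; apply: le_trans rn.
  by apply: (hoc_rho_noninc (a_num01 P_ge0 P_sum) (a_num_nd P_ge0 P_sum)); have := ltn_ord x; lia.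
rewrite sumr_const card_ord -[leLHS]mulr_natr -[leRHS](@divfK _ L.+1%:R) ?gt_eqF//.
by rewrite ler_wpM2l ?ler_nat// divr_ge0 ?ltW.
Qed.

Definition window_sets : set (set (paths int G)) :=
  [set E : set (paths int G) | measurable E /\
  exists s t : int, s <= t /\
   forall x y : int -> G, (forall j, s <= j <= t -> x j = y j) -> E x -> E y].

Lemma window_setsI : setI_closed window_sets.
Proof.
move=> A B [mA [s [t [st depA]]]] [mB [u [v [uv depB]]]].
split; first exact: measurableI.
exists (Num.min s u), (Num.max t v); split; first lia.
move=> x y xy [Ax Bx]; split.
  by apply: depA Ax => j jst; apply: xy; lia.
by apply: depB Bx => j jst; apply: xy; lia.
Qed.

Lemma window_sets_gen : measurable = <<s window_sets >>.
Proof.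
apply/seteqP; split.
  apply: sub_sigma_algebra2 => _ [i [A ->]]; split; first exact: measurable_coord.
  by exists i, i; split => // x y xy /=; rewrite xy ?lexx.
apply: smallest_sub; first exact: sigma_algebra_measurable.
by move=> A [].
Qed.

(** The lower bounds for [E] and for its complement enclose [nu E] in an interval that does not
    depend on [nu]. *)
Lemma lower_compatible_window nu (E : set (paths int G)) (s t : int) n : lower_compatible nu ->
  measurable E -> s <= t ->
  (forall x y : int -> G, (forall j, s <= j <= t -> x j = y j) -> E x -> E y) ->
  rlow P (window_indic E t) `|t - s|.+1 n [::] <= fine (nu E)
    <= rlow P (window_indic E t) `|t - s|.+1 n [::] + forget P `|t - s|.+1 n 0.
Proof.
move=> nuP mE st Edep; set L := `|t - s|%N.+1; set lo := rlow _ _ _ _ _.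
have ECdep (x y : int -> G) : (forall j, s <= j <= t -> x j = y j) -> (~` E) x -> (~` E) y.
  by move=> xy Ex Ey; apply: Ex; apply: Edep Ey => j jst; rewrite xy.
have lo_le := rlow_le_measure nuP mE st Edep n.
have hi_le := rlow_le_measure nuP (measurableC mE) st ECdep n.
have bnd F : exists M, forall z, window_indic F t z <= M.
  by exists 1 => z; rewrite /window_indic; case: asbool.
have ge0 F z : 0 <= window_indic F t z by rewrite ler0n.
have := low_add P_ge0 P_sum L n [::] (ge0 E) (ge0 (~` E)) (c := 1) _ ler01.
move=> /(_ _)/wrap[z|].
  by rewrite /window_indic asbool_neg; case: asboolP; rewrite ?addr0 ?add0r.
rewrite -!rlowE// -EFinD lee_fin mul1r -/lo => sum_ge.
move: lo_le hi_le; rewrite probability_setC// -[nu E]fineK ?fin_num_measure//.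
rewrite -EFinB !lee_fin => lo_le hi_le; rewrite lo_le/=.
rewrite -/L in hi_le; lra.
Qed.

(** Two such measures differ by at most any [e > 0] on events that depend on a finite window, and
    these form a generating family stable under intersection. *)
Lemma lower_compatible_unique (nu mu : probability (paths int G) R) :
  (\sum_(0 <= m <oo) (beta P m)%:E = +oo)%E ->
  lower_compatible nu -> lower_compatible mu ->
  forall A, measurable A -> nu A = mu A.
Proof.
move=> beta_oo nuP muP A mA.
apply: (measure_unique window_sets (fun=> setT)) => //.
- exact: window_sets_gen.
- exact: window_setsI.
- by move=> _; split => //; exists 0, 0.
- by rewrite bigcup_const.
- move=> E [mE [s [t [st Edep]]]].
  rewrite -[LHS]fineK ?fin_num_measure// -[RHS]fineK ?fin_num_measure//.
  congr EFin; apply/eqP; rewrite -subr_eq0 -normr_le0; apply/ler_addgt0Pl => e e0.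
  have [n ne] := forget_small `|t - s|.+1 beta_oo e0.
  have := lower_compatible_window n nuP mE st Edep.
  have := lower_compatible_window n muP mE st Edep.
  rewrite addr0 ler_norml; lra.
- by move=> _; rewrite -ge0_fin_numE// fin_num_measure.
Qed.

End lower_compatibility.

(** * From lower bounds to compatibility *)

Section integral_esum.
Context d (T : measurableType d) (R : realType) (mu : {measure set T -> \bar R}).
Variable (I : choiceType).

Lemma esum_integral_le (f : T -> \bar R) (F : I -> set T) (D : set T) :
  measurable D -> (forall i, measurable (F i)) -> trivIset setT F ->
  (forall i, F i `<=` D) -> measurable_fun D f -> (forall x, D x -> 0 <= f x)%E ->
  (\esum_(i in [set: I]) \int[mu]_(x in F i) f x <= \int[mu]_(x in D) f x)%E.
Proof.
move=> mD mF tF FD mf f0; apply: ge_ereal_sup => _ [X [finX _] <-].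
rewrite fsbig_finite//=.
have sub (r : seq I) : \big[setU/set0]_(i <- r) F i `<=` D.
  by elim/big_rec: _ => [//|i A _ AD]; rewrite subUset.
rewrite -ge0_integral_bigsetU//=.
- apply: ge0_subset_integral => //; exact: bigsetU_measurable.
- by apply: sub_trivIset tF.
- by apply: measurable_funS mf.
- by move=> x /sub /f0.
Qed.

End integral_esum.

Section compatibility.
Variables (R : realType) (G : pointedType) (rk : G -> nat).
Hypothesis rk_inj : injective rk.
Variable P : G -> (nat -> G) -> R.
Hypothesis P_ge0 : forall g w, 0 <= P g w.
Hypothesis P_sum : forall w, (\esum_(g in [set: G]) (P g w)%:E = 1)%E.
Hypothesis P_meas : forall g, measurable_fun [set: paths nat G] (P g : paths nat G -> R).

Definition rk_word (s : seq G) : nat := CodeSeq.code (map rk s).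

Lemma rk_word_inj : injective rk_word.
Proof. by apply: inj_comp (inj_map rk_inj); exact: can_inj CodeSeq.codeK. Qed.

(** For each letter the measure of the event and the integral of the kernel share a lower bound that
    nearly exhausts both totals, so [esum_pinch] makes them agree up to [e]. *)
Lemma lower_compatible_compatible (nu : probability (paths int G) R) :
  (forall e, 0 < e -> exists k, 1 - a_num P k <= e) ->
  lower_compatible P nu -> compatible P nu.
Proof.
move=> a_near nuP i g C mC.
pose D := past i @^-1` C : set (paths int G).
have mD : measurable D by exact: measurable_past_preim.
have mcoord h : measurable [set x : paths int G | x i = h] by exact: (measurable_coord i [set h]).
pose p h := nu ([set x : paths int G | x i = h] `&` D).
pose q h := (\int[nu]_(x in D) (P h (past i x))%:E)%E.
have mP h : measurable_fun D (fun x : paths int G => (P h (past i x))%:E).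
  by apply: measurable_funTS; exact: kernel_past_measurable.
have p_le : (\esum_(h in [set: G]) p h <= nu D)%E.
  by rewrite (measure_split_coord rk_inj nu i mD).
have q_le : (\esum_(h in [set: G]) q h <= nu D)%E.
  apply: ge_ereal_sup => _ [X [finX _] <-]; rewrite /q -ge0_integral_fsum//; last first.
    by move=> h x _; rewrite lee_fin.
  rewrite -[leRHS]mul1e -integral_cst//; apply: ge0_le_integral => //.
  - by move=> x _; apply: fsume_ge0 => h _; rewrite lee_fin.
  - by apply: emeasurable_fsum => // h; exact: mP.
  - move=> x _; rewrite -(P_sum (past i x)); apply: ereal_sup_ubound.
    by exists X.
(* [al h] bounds from below both the measure and the integral attached to [h],
   and misses at most [(1 - a_num P k) * nu D] of the total mass of either. *)
have key e : 0 < e -> exists al : G -> \bar R, [/\ forall h, (0 <= al h <= p h)%E,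
    forall h, (al h <= q h)%E & (nu D <= \esum_(h in [set: G]) al h + e%:E)%E].
  move=> e0; have [k ke] := a_near e e0.
  (* The equation [mkseq h k = s] forces [size s = k]; the pieces for words of other sizes are
     empty. *)
  pose Cs s := C `&` [set h : paths nat G | mkseq h k = s].
  pose Ds s := past i @^-1` (Cs s) : set (paths int G).
  have mCs s : measurable (Cs s) by apply: measurableI => //; exact: measurable_mkseq.
  have mDs s : measurable (Ds s) by exact: measurable_past_preim.
  have sCs s : starts_with s (Cs s).
    by move=> h [_ /= hs]; rewrite -{1}hs size_mkseq.
  have tDs : trivIset setT Ds by move=> s r _ _ [x [[_ /= <-] [_ /= <-]]].
  have DE : \bigcup_s Ds s = D.
    apply/seteqP; split => [x [s _ []]//|x Dx].
    by exists (mkseq (past i x) k).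
  exists (fun h => \esum_(s in [set: seq G]) ((a_word P s h)%:E * nu (Ds s)))%E.
  have a0 s h : (0 <= (a_word P s h)%:E)%E by rewrite lee_fin a_word_ge0.
  split=> [h|h|].
  - apply/andP; split; first by apply: esum_ge0 => s _; rewrite mule_ge0.
    have -> : p h = (\esum_(s in [set: seq G]) nu ([set x : paths int G | x i = h] `&` Ds s))%E.
      rewrite -(measure_label_bigcup rk_word_inj nu).
      + by rewrite -setI_bigcupr DE.
      + by move=> s; exact: measurableI.
      + by move=> s r _ _ [x [[_ ?] [_ ?]]]; apply: tDs => //; exists x.
    by apply: le_esum => s _; exact: nuP.
  - apply: le_trans (esum_integral_le _ mD mDs tDs _ (mP h) _).
    + apply: le_esum => s _; rewrite -integral_cst//; apply: ge0_le_integral => //.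
      * by move=> x _; exact: a0.
      * by apply: measurable_funTS; exact: kernel_past_measurable.
      * by move=> x Dx; rewrite lee_fin a_word_starts// sCs.
    + by move=> s x [].
    + by move=> x _; rewrite lee_fin.
  - rewrite esum_swap => [|h s]; last by rewrite mule_ge0.
    apply: (@le_trans _ _ ((a_num P k)%:E * nu D + e%:E)%E).
      rewrite -[nu D]fineK ?fin_num_measure// -EFinM -EFinD lee_fin.
      have c1 : fine (nu D) <= 1.
        by rewrite -lee_fin fineK ?fin_num_measure// probability_le1.
      have c0 : 0 <= fine (nu D) by rewrite fine_ge0.
      have := a_num01 P_ge0 P_sum k; nra.
    rewrite leeD2r// -DE (measure_label_bigcup rk_word_inj nu)//.
    rewrite -esumZl//; last by case/andP: (a_num01 P_ge0 P_sum k).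
    apply: le_esum => s _.
    under eq_esum do rewrite muleC.
    rewrite -[nu (Ds s)]fineK ?fin_num_measure// esumZl ?fine_ge0//.
    rewrite a_sumE// muleC fineK ?fin_num_measure//.
    case: (eqVneq (size s) k) => [<-|sk].
      by rewrite lee_wpmul2l ?lee_fin ?a_num_le.
    rewrite (_ : Ds s = set0) ?measure0 ?mul0e//.
    apply/seteqP; split => // x [_ /= xs].
    by rewrite -xs size_mkseq eqxx in sk.
have c_fin : nu D = (fine (nu D))%:E by rewrite fineK ?fin_num_measure.
rewrite -/(p g) -/(q g); apply/eqP; rewrite eq_le; apply/andP; split.
  apply/lee_addgt0Pr => e e0; have [al [alp alq sum]] := key e e0.
  rewrite c_fin in p_le sum.
  by apply: le_trans (esum_pinch g alp p_le sum) _; rewrite leeD2r.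
apply/lee_addgt0Pr => e e0; have [al [alp alq sum]] := key e e0.
rewrite c_fin in q_le sum.
have alq' h : (0 <= al h <= q h)%E by rewrite alq andbT; case/andP: (alp h).
apply: le_trans (esum_pinch g alq' q_le sum) _; rewrite leeD2r//.
by case/andP: (alp g).
Qed.

End compatibility.

(** * The intervals B_k and the map Phi *)

Section intervals.
Variables (R : realType) (G : pointedType) (rk : G -> nat).
Hypothesis rk_inj : injective rk.
Variable P : G -> (nat -> G) -> R.
Hypothesis P_ge0 : forall g w, 0 <= P g w.
Hypothesis P_sum : forall w, (\esum_(g in [set: G]) (P g w)%:E = 1)%E.
Implicit Types (h : nat -> G) (g : G) (l k : nat).

Lemma b_word_ge0 s g : 0 <= b_word P s g.
Proof.
by case: s => [|x s]; rewrite /b_word ?a_word_ge0// subr_ge0 a_word_take.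
Qed.

Lemma b_wordS h l g :
  b_word P (mkseq h l.+1) g = a_word P (mkseq h l.+1) g - a_word P (mkseq h l) g.
Proof.
by rewrite -[in X in _ - X](take_mkseq h (leqnSn l)) /b_word /= size_map size_iota.
Qed.

(* By telescoping, the total length of the intervals of level below [l]. *)
Definition b_cum h l : R := if l is k.+1 then a_sum P (mkseq h k) else 0.

Lemma b_sumE h l :
  (\esum_(g in [set: G]) (b_word P (mkseq h l) g)%:E = (b_cum h l.+1 - b_cum h l)%:E)%E.
Proof.
case: l => [|l]; first by rewrite /b_cum subr0 -a_sumE.
have : (\esum_(g in [set: G]) (b_word P (mkseq h l.+1) g)%:E + (b_cum h l.+1)%:E
    = (b_cum h l.+2)%:E)%E.
  rewrite /b_cum -!a_sumE// -esumD => [|g _|g _]; rewrite ?lee_fin ?b_word_ge0 ?a_word_ge0//.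
  by apply: eq_esum => g _; rewrite b_wordS -EFinD subrK.
case: (\esum_(_ in _) _)%E => //= r; rewrite -EFinD => -[<-].
by rewrite addrK.
Qed.

Lemma b_cum_nd h : {homo b_cum h : k l / (k <= l)%N >-> k <= l}.
Proof.
apply: homo_leq => [//|x y z|l]; first exact: le_trans.
rewrite -subr_ge0 -lee_fin -b_sumE; apply: esum_ge0 => g _.
by rewrite lee_fin b_word_ge0.
Qed.

Lemma b_cum_le1 h l : b_cum h l <= 1.
Proof. by case: l => [|l] /=; rewrite ?ler01//; case/andP: (a_sum01 P_ge0 P_sum (mkseq h l)). Qed.

Lemma b_cum_ge0 h l : 0 <= b_cum h l.
Proof. by case: l => [|l] //=; case/andP: (a_sum01 P_ge0 P_sum (mkseq h l)). Qed.

Definition b_part h l n : R :=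
  fine (\esum_(g in [set g | (rk g < n)%N]) (b_word P (mkseq h l) g)%:E).

Lemma esum_b_le h l (A : set G) :
  (\esum_(g in A) (b_word P (mkseq h l) g)%:E <= (b_cum h l.+1 - b_cum h l)%:E)%E.
Proof.
rewrite -b_sumE (esumID A setT)// => [|g _]; last by rewrite lee_fin b_word_ge0.
by rewrite setTI leeDl//; apply: esum_ge0 => g _; rewrite lee_fin b_word_ge0.
Qed.

Lemma b_partE h l n :
  (\esum_(g in [set g | (rk g < n)%N]) (b_word P (mkseq h l) g)%:E = (b_part h l n)%:E)%E.
Proof.
rewrite /b_part fineK// ge0_fin_numE; last first.
  by apply: esum_ge0 => g _; rewrite lee_fin b_word_ge0.
by apply: le_lt_trans (esum_b_le _ _ _) _; exact: ltry.
Qed.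

Lemma b_part_le h l n : b_part h l n <= b_cum h l.+1 - b_cum h l.
Proof. by rewrite -lee_fin -b_partE esum_b_le. Qed.

Lemma b_part_ge0 h l n : 0 <= b_part h l n.
Proof.
by rewrite -lee_fin -b_partE; apply: esum_ge0 => g _; rewrite lee_fin b_word_ge0.
Qed.

Lemma b_part_nd h l : {homo b_part h l : m n / (m <= n)%N >-> m <= n}.
Proof.
move=> m n mn; rewrite -lee_fin -!b_partE.
rewrite [leRHS](esumID [set g | (rk g < m)%N]) => [|g _]; last by rewrite lee_fin b_word_ge0.
rewrite (_ : _ `&` [set g | (rk g < m)%N] = [set g | (rk g < m)%N]).
  by rewrite leeDl//; apply: esum_ge0 => g _; rewrite lee_fin b_word_ge0.
by apply/seteqP; split => x /= => [[]//|xm]; split => //; exact: leq_trans mn.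
Qed.

Lemma b_partS h l g : b_part h l (rk g).+1 = b_part h l (rk g) + b_word P (mkseq h l) g.
Proof.
apply: EFin_inj; rewrite EFinD -!b_partE.
rewrite (esumID [set x | (rk x < rk g)%N]) => [|x _]; last by rewrite lee_fin b_word_ge0.
rewrite (_ : _ `&` [set x | (rk x < rk g)%N] = [set x | (rk x < rk g)%N]).
  rewrite (_ : _ `&` ~` _ = [set g]) ?esum_set1 ?lee_fin ?b_word_ge0//.
  apply/seteqP; split => x /=; last by move=> ->; split => //; rewrite ltnn.
  by rewrite ltnS => -[xg /negP]; rewrite -leqNgt => gx; apply: rk_inj; lia.
by apply/seteqP; split => x /= => [[]//|xg]; split => //; lia.
Qed.

Lemma b_partS0 h l n : (forall g, rk g <> n) -> b_part h l n.+1 = b_part h l n.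
Proof.
move=> gn; apply: EFin_inj; rewrite -!b_partE; congr (esum _ _).
by apply/seteqP; split => x /=; have := gn x; lia.
Qed.

Lemma B_leftE h l g :
  (B_left rk P (mkseq h l) g = (b_cum h l + b_part h l (rk g))%:E)%E.
Proof.
rewrite /B_left EFinD b_partE; congr (_ + _)%E.
have -> : b_cum h l = \sum_(k < l) (b_cum h k.+1 - b_cum h k).
  by rewrite -(big_mkord xpredT (fun k => b_cum h k.+1 - b_cum h k)) telescope_sumr// subr0.
rewrite -sumEFin size_mkseq; apply: eq_bigr => k _.
by rewrite take_mkseq ?b_sumE// ltnW.
Qed.

Lemma B_intE h l g v : B_int rk P (mkseq h l) g v <->
  b_cum h l + b_part h l (rk g) <= v < b_cum h l + b_part h l (rk g).+1.
Proof.
by rewrite /B_int /= B_leftE -EFinD lee_fin lte_fin -addrA -b_partS.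
Qed.

Lemma B_int_cum h l g v : B_int rk P (mkseq h l) g v -> b_cum h l <= v < b_cum h l.+1.
Proof.
move=> /B_intE /andP[lev ltv]; apply/andP; split.
  by apply: le_trans lev; rewrite lerDl b_part_ge0.
by apply: lt_le_trans ltv _; have := b_part_le h l (rk g).+1; lra.
Qed.

Lemma B_int_level h l k g g' v : B_int rk P (mkseq h l) g v ->
  B_int rk P (mkseq h k) g' v -> l = k.
Proof.
move=> /B_int_cum /andP[l1 l2] /B_int_cum /andP[k1 k2].
have [lk|kl|//] := ltngtP l k.
  by have := lt_le_trans l2 (le_trans (b_cum_nd h lk) k1); rewrite ltxx.
by have := lt_le_trans k2 (le_trans (b_cum_nd h kl) l1); rewrite ltxx.
Qed.

Lemma B_int_inj h l k g g' v : B_int rk P (mkseq h l) g v ->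
  B_int rk P (mkseq h k) g' v -> g = g'.
Proof.
move=> lg kg; have lk := B_int_level lg kg; rewrite {}lk in lg.
move: lg kg => /B_intE /andP[g1 g2] /B_intE /andP[h1 h2].
apply: rk_inj; have [lt|lt|//] := ltngtP (rk g) (rk g').
  by exfalso; have := b_part_nd h k lt; lra.
by exfalso; have := b_part_nd h k lt; lra.
Qed.

(** The total is a supremum over finite sets of letters, and a finite set has a largest rank. *)
Lemma b_part_lim h l v : v < b_cum h l.+1 - b_cum h l -> exists n, v < b_part h l n.
Proof.
rewrite -lte_fin -b_sumE => /ereal_sup_gt[_ [X [finX _] <-]].
have [s XE] := (finite_seqP _).1 finX.
move=> vX; exists (\max_(x <- s) rk x).+1.
rewrite -lte_fin -b_partE; apply: lt_le_trans vX _; apply: ereal_sup_ubound.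
exists X => //; split => // x; rewrite XE /= => xs.
by rewrite ltnS; exact: leq_bigmax_seq.
Qed.

(** Take the first level, and within it the first rank, whose right endpoint exceeds [v]. *)
Lemma B_int_cover h k v : 0 <= v < b_cum h k ->
  exists2 l, (l < k)%N & exists g, B_int rk P (mkseq h l) g v.
Proof.
move=> /andP[v0 vk].
have exl : exists l, v < b_cum h l by exists k.
case: (ex_minnP exl) => -[|l] /= vl lmin; first by rewrite ltNge v0 in vl.
exists l; first exact: lmin.
have lv : b_cum h l <= v by rewrite leNgt; apply/negP => /lmin; rewrite ltnn.
have exn : exists n, v - b_cum h l < b_part h l n by apply: b_part_lim; rewrite ltrD2r.
case: (ex_minnP exn) => -[|n] vn nmin.
  move: vn; rewrite ltNge => /negP[].
  have -> : b_part h l 0 = 0.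
    apply: EFin_inj; rewrite -b_partE (_ : [set g | _] = set0) ?esum_set0//.
    by apply/seteqP; split.
  by rewrite subr_ge0.
have nv : b_part h l n <= v - b_cum h l.
  by rewrite leNgt; apply/negP => /nmin; rewrite ltnn.
(* The rank [n] belongs to a letter, since otherwise [b_part] would not grow from [n] to [n.+1]. *)
have [[g gn]|no] := pselect (exists g, rk g = n); last first.
  by move: vn; rewrite b_partS0 ?ltNge ?nv// => g gn; apply: no; exists g.
by exists g; apply/B_intE; rewrite gn; lra.
Qed.

(** * Letter selection, coherence of runs and the recursion satisfied by Phi *)

Section letters.
Variable g0 : G.

Lemma a_num_b_cum h k : a_num P k <= b_cum h k.+1.
Proof. by rewrite -[k in a_num _ k](size_mkseq h k); exact: a_num_le. Qed.

(** The levels up to [k] have total length at least [a_num P k], so some interval contains [v] and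
    [letter] does not fall back on [g0]. *)
Lemma letterP h k v : 0 <= v < a_num P k ->
  exists l, B_int rk P (mkseq h l) (letter rk P g0 v (mkseq h k)) v.
Proof.
move=> /andP[v0 vk].
have : 0 <= v < b_cum h k.+1 by rewrite v0 (lt_le_trans vk)// a_num_b_cum.
move=> /B_int_cover[l lk [g gv]]; rewrite /letter.
case: xgetP => [x -> [l' /=]|/(_ g)[]].
  by rewrite size_mkseq => l'k [_]; rewrite take_mkseq//; exists l'.
exists l; rewrite ?size_mkseq//; split; last by rewrite take_mkseq.
by rewrite /= in_itv /= v0 size_mkseq.
Qed.

Lemma letter_eq h k l g v : 0 <= v < a_num P k -> B_int rk P (mkseq h l) g v ->
  letter rk P g0 v (mkseq h k) = g.
Proof. by move=> /(letterP h)[l' hl'] hl; exact: B_int_inj hl' hl. Qed.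

(** For [v < a_num P k] the interval containing [v] has level at most [k], so letters older than the
    last [k] have no influence. This makes runs with different starting times agree. *)
Lemma letter_take s k v : (k <= size s)%N -> 0 <= v < a_num P k ->
  letter rk P g0 v s = letter rk P g0 v (take k s).
Proof.
move=> ks vk; pose h := prepend s (fun=> point).
have sE : s = mkseq h (size s) by rewrite mkseq_prepend.
rewrite sE take_mkseq//; have [l hl] := letterP h vk.
apply: letter_eq hl; case/andP: vk => -> /lt_le_trans; apply.
exact: a_num_nd.
Qed.

Variable u : int -> R.
Hypothesis u_ge0 : forall i, 0 <= u i.

Definition good_run (m : int) (n : nat) : Prop :=
  forall k, (k < n)%N -> u (m + k%:Z) < a_num P k.

Let gen := generate rk P g0 u.

Lemma size_generate m n : size (gen m n) = n.
Proof. by elim: n => //= n ->. Qed.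

(** By [letter_take], each letter from time [m + d] on is determined by those produced since
    [m + d], whatever the run from [m] produced earlier. *)
Lemma generate_coherent m d n : good_run (m + d%:Z) n ->
  take n (gen m (d + n)) = gen (m + d%:Z) n.
Proof.
elim: n => [|n IH] good; first by rewrite take0.
have {}IH := IH (fun k kn => good k (leqW kn)).
rewrite addnS /= -/(gen _ _) IH; congr (_ :: _).
rewrite [LHS](@letter_take _ n).
- by rewrite IH (_ : m + _ = m + d%:Z + n%:Z)//; lia.
- by rewrite size_generate leq_addl.
- rewrite u_ge0 (_ : m + _ = m + d%:Z + n%:Z); first exact: good.
  lia.
Qed.

Definition run_start (n m : int) : Prop := m <= n /\ good_run m `|n - m|.+1.

Lemma run_startE n : [set m : int | m <= n /\
    forall k : int, m <= k <= n -> u k < a_num P `|k - m|%N] = run_start n.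
Proof.
apply/seteqP; split => m [mn run]; split => //.
  move=> k kn; have := run (m + k%:Z); rewrite (_ : `|(m + k%:Z - m)%R|%N = k); last lia.
  by apply; lia.
move=> k kn; have := run `|k - m|%N; rewrite (_ : m + `|k - m|%N%:Z = k); last lia.
by apply; lia.
Qed.

Lemma tau_some n m : tau P u n = Some m ->
  run_start n m /\ forall r, run_start n r -> r <= m.
Proof.
rewrite /tau run_startE; case: xgetP => [_ -> [r [rn ub] <-] [<-]|//].
by split => // q /ub.
Qed.

Lemma tau_exists n m : run_start n m -> exists r, tau P u n = Some r /\ m <= r.
Proof.
move=> start; rewrite /tau run_startE.
have exd : exists d : nat, `[< run_start n (n - d%:Z) >].
  exists `|n - m|%N; apply/asboolP; case: (start) => mn _.
  by rewrite (_ : n - _ = m)//; lia.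
case: (ex_minnP exd) => d /asboolP dS dmin.
have max r : run_start n r -> r <= n - d%:Z.
  move=> rS; have rn : r <= n by case: rS.
  have := dmin `|n - r|%N; rewrite (_ : n - `|n - r|%N%:Z = r); last lia.
  by move=> /(_ (asboolT rS)); lia.
case: xgetP => [_ -> [r [rn ub] <-]|/(_ (Some (n - d%:Z)))[]].
  by exists r; split => //; exact: ub.
by exists (n - d%:Z) => //; split => // r /max.
Qed.

(** The value of [tau] may exceed [m]; coherence identifies the run from [tau] with the end of the
    run from [m]. *)
Lemma Phi_run m n : good_run m n.+1 ->
  Phi rk P g0 u (m + n%:Z) = head g0 (gen m n.+1).
Proof.
move=> good.
have /tau_exists[r [tr mr]] : run_start (m + n%:Z) m.
  split; first lia.
  by rewrite (_ : `|(m + n%:Z - m)%R|%N = n)//; lia.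
have [[rn rgood] _] := tau_some tr.
rewrite /Phi tr -/gen; set q := `|_|%N in rgood *.
pose d := `|r - m|%N.
have rE : r = m + d%:Z by rewrite /d; lia.
rewrite {1}rE -generate_coherent -?rE//.
by rewrite (_ : (d + q.+1)%N = n.+1) /q /d//; lia.
Qed.

Lemma generate_Phi m n : good_run m n ->
  gen m n = mkseq (past (m + n%:Z) (Phi rk P g0 u)) n.
Proof.
elim: n => [//|n IH] good.
rewrite /gen /mkseq /= (iotaDl 1 0) -map_comp -/gen.
have {}IH := IH (fun k kn => good k (leqW kn)).
have -> : letter rk P g0 (u (m + n%:Z)) (gen m n) = past (m + n.+1%:Z) (Phi rk P g0 u) 0.
  by rewrite /past (_ : m + n.+1%:Z - 1%:Z = m + n%:Z) ?Phi_run//; lia.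
rewrite IH; congr (_ :: _); apply: eq_map => k /=.
by rewrite /past; congr Phi; lia.
Qed.

(** The recursion satisfied by [Phi]: [u n] selects the letter from the past of [Phi] itself, at a
    level [l] that is not tied to [tau]. *)
Lemma Phi_letter n l g : tau P u n != None ->
  B_int rk P (mkseq (past n (Phi rk P g0 u)) l) g (u n) -> Phi rk P g0 u n = g.
Proof.
case tr : (tau P u n) => [m|//] _ hl.
have [[mn good] _] := tau_some tr.
pose k := `|n - m|%N.
have nE : n = m + k%:Z by rewrite /k; lia.
rewrite {1}nE Phi_run// [LHS]/= -/gen generate_Phi => [|j jk]; last exact/good/leqW.
rewrite -nE; apply: letter_eq hl.
by rewrite u_ge0 [n in u n]nE good.
Qed.

End letters.
End intervals.

(** * Measurability and independence *)

Section measurability_of_Phi.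
Variables (R : realType) (G : pointedType) (rk : G -> nat).
Hypothesis rk_inj : injective rk.
Variable P : G -> (nat -> G) -> R.
Hypothesis P_ge0 : forall g w, 0 <= P g w.
Hypothesis P_sum : forall w, (\esum_(g in [set: G]) (P g w)%:E = 1)%E.
Variable g0 : G.

Lemma B_int_itv h l g : B_int rk P (mkseq h l) g =
  `[b_cum P h l + b_part rk P h l (rk g), b_cum P h l + b_part rk P h l (rk g).+1[%classic.
Proof.
apply/seteqP; split => v; first by move=> /(B_intE rk_inj P_ge0 P_sum); rewrite /= in_itv.
by rewrite /= in_itv/= => vg; apply/(B_intE rk_inj P_ge0 P_sum).
Qed.

Lemma measurable_B_int h l g : measurable (B_int rk P (mkseq h l) g).
Proof. by rewrite B_int_itv. Qed.

Lemma measurable_letter s g : measurable [set v : R | letter rk P g0 v s = g].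
Proof.
pose h := prepend s (fun=> point : G).
have sE : s = mkseq h (size s) by rewrite mkseq_prepend.
pose D x := [set v : R | exists2 l, (l <= size s)%N & B_cut rk P l s x v].
have mD x : measurable (D x).
  rewrite (_ : D x = \bigcup_(l in [set l | (l <= size s)%N]) B_cut rk P l s x).
    apply: bigcup_measurable => l /= ls; apply: measurableI => //.
    by rewrite sE take_mkseq//; exact: measurable_B_int.
  by apply/seteqP; split => v [l ls vl]; exists l.
have D_inj x y v : D x v -> D y v -> x = y.
  move=> [l ls [_ vl]] [k ks [_ vk]].
  rewrite sE !take_mkseq// in vl vk; exact: (B_int_inj rk_inj P_ge0 P_sum) vl vk.
have DE v x : D x v -> letter rk P g0 v s = x.
  move=> vx; rewrite /letter; case: xgetP => [y -> vy|/(_ x)//].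
  exact: D_inj vy vx.
have D0 v : (forall x, ~ D x v) -> letter rk P g0 v s = g0.
  by move=> no; rewrite /letter; case: xgetP => [y -> /no|].
(* Outside all the intervals [letter] takes its default value [g0]. *)
rewrite (_ : [set v | _] = D g `|` (~` (\bigcup_x D x) `&` [set _ | g = g0])).
  apply: measurableU => //; apply: measurableI; last first.
    by have [->|ne] := pselect (g = g0); [rewrite (_ : [set _ | _] = setT)//|
      rewrite (_ : [set _ | _] = set0)//]; apply/seteqP; split.
  by apply: measurableC; apply: (bigcup_label_measurable rk_inj).
apply/seteqP; split => v /=.
  move=> <-; have [[x vx]|no] := pselect (exists x, D x v).
    by left; rewrite (DE _ _ vx).
  right; split; first by move=> [x _ vx]; apply: no; exists x.
  by apply: D0 => x vx; apply: no; exists x.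
case=> [/DE//|[no ->]]; apply: D0 => x vx; apply: no; by exists x.
Qed.

Section measurable_family.
Context d (T : measurableType d) (V : int -> T -> R) (n : int).
Hypothesis mV : forall j, j <= n -> measurable_fun [set: T] (V j).

Lemma measurable_generate m k s : m + k%:Z <= n + 1 ->
  measurable [set x | generate rk P g0 (V^~ x) m k = s].
Proof.
elim: k s => [|k IH] s kn /=.
  have [<-|ne] := pselect ([::] = s).
    by rewrite (_ : [set _ | _] = setT)//; apply/seteqP; split.
  by rewrite (_ : [set _ | _] = set0)//; apply/seteqP; split.
case: s => [|g s]; first by rewrite (_ : [set _ | _] = set0)//; apply/seteqP; split.
rewrite (_ : [set _ | _] = [set x | generate rk P g0 (V^~ x) m k = s] `&`
   V (m + k%:Z) @^-1` [set v | letter rk P g0 v s = g]).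
  apply: measurableI; first by apply: IH; lia.
  rewrite -[X in measurable X]setTI; apply: mV => //; first lia.
  exact: measurable_letter.
by apply/seteqP; split => x /=; [move=> [<- <-]|move=> [-> <-]].
Qed.

Lemma measurable_lt j c : j <= n -> measurable [set x | V j x < c].
Proof.
move=> jn; rewrite (_ : [set _ | _] = V j @^-1` `]-oo, c[%classic).
  by rewrite -[X in measurable X]setTI; exact: mV.
by apply/seteqP; split => x /=; rewrite in_itv.
Qed.

Lemma measurable_good_run m k : m + k%:Z <= n + 1 ->
  measurable [set x | good_run P (V^~ x) m k].
Proof.
move=> kn.
rewrite (_ : [set _ | _] = \bigcap_(j in `I_k) [set x | V (m + j%:Z) x < a_num P j]).
  by apply: bigcap_measurableType => j /= jk; apply: measurable_lt; lia.
by apply/seteqP; split => x /= H j /H.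
Qed.

Lemma measurable_run_start j m : j <= n ->
  measurable [set x | run_start P (V^~ x) j m].
Proof.
move=> jn; have [mj|jm] := leP m j.
  rewrite (_ : [set _ | _] = [set x | good_run P (V^~ x) m `|j - m|.+1]).
    by apply: measurable_good_run; lia.
  by apply/seteqP; split => x; [case|split].
rewrite (_ : [set _ | _] = set0)//; apply/seteqP; split => // x [].
by rewrite leNgt jm.
Qed.

(** Maximality is expressed by countably many exclusions, from which measurability can be read
    off. *)
Lemma tau_someP u j m : tau P u j = Some m <->
  run_start P u j m /\ forall k : nat, ~ run_start P u j (m + k.+1%:Z).
Proof.
split=> [/tau_some[start ub]|[start no]].
  by split => // k /ub; lia.
have [r [tr mr]] := tau_exists start; rewrite tr; congr Some.
have [rstart _] := tau_some tr.
apply/eqP; rewrite eq_le mr andbT leNgt; apply/negP => lt_mr.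
by apply: (no `|r - m|.-1); rewrite (_ : m + _ = r)//; lia.
Qed.

Lemma measurable_tau_some j m : j <= n ->
  measurable [set x | tau P (V^~ x) j = Some m].
Proof.
move=> jn; rewrite (_ : [set _ | _] = [set x | run_start P (V^~ x) j m] `&`
    \bigcap_k ~` [set x | run_start P (V^~ x) j (m + k.+1%:Z)]).
  apply: measurableI; first exact: measurable_run_start.
  by apply: bigcapT_measurable => k; apply: measurableC; exact: measurable_run_start.
apply/seteqP; split => x /=.
  by move=> /tau_someP[? no]; split => // k _; exact: no.
by move=> [? no]; apply/tau_someP; split => // k; exact: no.
Qed.

Lemma pickle_int_inj : injective (@pickle int).
Proof. exact: pcan_inj pickleK. Qed.

Lemma measurable_tau_none j : j <= n ->
  measurable [set x | tau P (V^~ x) j = None].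
Proof.
move=> jn; rewrite (_ : [set _ | _] = ~` \bigcup_m [set x | tau P (V^~ x) j = Some m]).
  apply: measurableC; apply: (bigcup_label_measurable pickle_int_inj) => m _.
  exact: measurable_tau_some.
apply/seteqP; split => x /=; first by move=> tr [m _ /=]; rewrite tr.
by case tr: (tau _ _ _) => [m|//] []; exists m.
Qed.

Lemma measurable_Phi j g : j <= n ->
  measurable [set x | Phi rk P g0 (V^~ x) j = g].
Proof.
move=> jn.
have -> : [set x | Phi rk P g0 (V^~ x) j = g] =
  \bigcup_m ([set x | tau P (V^~ x) j = Some m] `&`
     \bigcup_s [set x | generate rk P g0 (V^~ x) m `|j - m|.+1 = g :: s]) `|`
  ([set x | tau P (V^~ x) j = None] `&` [set x | g0 = g]).
  apply/seteqP; split => x /=.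
    rewrite /Phi; case tr: (tau _ _ _) => [m|]; last by right.
    move=> /= <-; left; exists m => //; split => //.
    by exists (generate rk P g0 (V^~ x) m `|j - m|).
  by rewrite /Phi; case=> [[m _ [/= -> [s _ /= [gs _]]]]|[/= -> ->]].
apply: measurableU; last first.
  apply: measurableI; first exact: measurable_tau_none.
  by have [<-|ne] := pselect (g0 = g); [rewrite (_ : [set _ | _] = setT)//|
    rewrite (_ : [set _ | _] = set0)//]; apply/seteqP; split.
apply: (bigcup_label_measurable pickle_int_inj) => m _.
have [mj|jm] := leP m j; last first.
  rewrite (_ : _ `&` _ = set0)//; apply/seteqP; split => // x [/= /tau_some[[]]].
  by rewrite leNgt jm.
apply: measurableI; first exact: measurable_tau_some.
apply: (bigcup_label_measurable (rk_word_inj rk_inj)) => s _.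
by apply: measurable_generate; lia.
Qed.

End measurable_family.
End measurability_of_Phi.

(** * Independence of each uniform variable from the earlier ones *)

Section independence.
Variables (R : realType) (d : measure_display) (T : measurableType d).
Variables (Pr : probability T R) (U : int -> {RV Pr >-> R}).
Hypothesis U_iid : iid_uniform U.

Let Uvec (x : T) : int -> R := fun i => U i x.

(* Only finite intersections are taken as generators, so that they form a
   pi-system. *)
Definition past_cylinders (n : int) : set (set (int -> R)) :=
  [set E | exists (J : seq int) (A : int -> set R),
    [/\ uniq J, forall j, j \in J -> j < n, forall j, measurable (A j) &
        E = [set u | forall j, j \in J -> A j (u j)]]].

Notation before n := (g_sigma_algebraType (past_cylinders n)).

Lemma past_cylindersI n : setI_closed (past_cylinders n).
Proof.
move=> _ _ [J [A [uJ Jn mA ->]]] [K [B [uK Kn mB ->]]].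
exists (undup (J ++ K)), (fun j => (if j \in J then A j else setT) `&`
   (if j \in K then B j else setT)); split.
- exact: undup_uniq.
- by move=> j; rewrite mem_undup mem_cat => /orP[/Jn|/Kn].
- by move=> j; apply: measurableI; case: ifP.
- apply/seteqP; split => u /=.
    by move=> [HA HB] j _; split; case: ifP => // ?; [exact: HA|exact: HB].
  move=> H; split => j jJ.
    by have := H j; rewrite mem_undup mem_cat jJ => /(_ isT)[].
  by have := H j; rewrite mem_undup mem_cat jJ orbT => /(_ isT)[].
Qed.

Lemma measurable_before_coord n j : j < n ->
  measurable_fun [set: before n] ((fun u => u j) : before n -> R).
Proof.
move=> jn _ A mA; rewrite setTI; apply: sub_sigma_algebra.
exists [:: j], (fun=> A); split => //.
  by move=> i; rewrite inE => /eqP->.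
apply/seteqP; split => u /=; first by move=> uA i; rewrite inE => /eqP->.
by move=> H; apply: H; rewrite inE.
Qed.

Lemma measurable_Upreim i (B : set R) : measurable B -> measurable (U i @^-1` B).
Proof. by move=> mB; rewrite -[X in measurable X]setTI; exact: measurable_funPT. Qed.

Lemma measurable_Uvec n (E : set (before n)) : measurable E ->
  measurable (Uvec @^-1` E).
Proof.
move=> mE; rewrite -[X in measurable X]setTI.
suff : measurable_fun [set: T] (Uvec : T -> before n) by exact.
apply: (measurability (past_cylinders n : set (set (before n)))) => //.
move=> _ [_ [J [A [_ _ mA ->]]] <-]; rewrite setTI.
rewrite (_ : _ @^-1` _ = \bigcap_(j in [set` J]) (U j @^-1` A j)).
  by apply: fin_bigcap_measurable => // j _; exact: measurable_Upreim.
by apply/seteqP; split => x H j /H.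
Qed.

Lemma indepC (E F : set T) : measurable E -> measurable F ->
  (Pr (E `&` F) = Pr E * Pr F)%E -> (Pr (~` E `&` F) = Pr (~` E) * Pr F)%E.
Proof.
move=> mE mF EF; have ID : (Pr F = Pr (F `\` E) + Pr (F `&` E))%E := measureDI Pr mF mE.
rewrite setIC -setDE probability_setC//; move: ID; rewrite [F `&` E]setIC EF.
have mD := measurableD mF mE.
rewrite -[Pr (F `\` E)]fineK ?fin_num_measure// -[Pr E]fineK ?fin_num_measure//.
rewrite -[Pr F]fineK ?fin_num_measure// -EFinB -!EFinM -EFinD => -[DE].
by congr EFin; lra.
Qed.

(** Dynkin induction on the event before [n]; for a finite cylinder it is mutual independence along
    [J] and along [n :: J]. *)
Lemma before_independent n (E : set (before n)) (B : set R) :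
  measurable E -> measurable B ->
  (Pr (Uvec @^-1` E `&` U n @^-1` B) = Pr (Uvec @^-1` E) * Pr (U n @^-1` B))%E.
Proof.
move=> + mB; have mUB := measurable_Upreim n mB.
apply: (@dynkin_induction _ (before n) (past_cylinders n)
  (fun E => Pr (Uvec @^-1` E `&` U n @^-1` B) = Pr (Uvec @^-1` E) * Pr (U n @^-1` B))%E).
- by [].
- exact: past_cylindersI.
- by rewrite preimage_setT setTI probability_setT mul1e.
- move=> _ [J [A [uJ Jn mA ->]]] /=.
  have [_ _ indep] := U_iid.
  have nJ : n \notin J by apply/negP => /Jn; rewrite ltxx.
  have -> : Uvec @^-1` [set u | forall j, j \in J -> A j (u j)] =
     \bigcap_(j in [set` J]) (U j @^-1` A j).
    by apply/seteqP; split => x H j /H.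
  rewrite indep//.
  pose A' j := if j == n then B else A j.
  have mA' j : measurable (A' j) by rewrite /A'; case: ifP.
  have := indep (n :: J) A' _ mA'; rewrite /= nJ => /(_ uJ).
  rewrite big_cons {2}/A' eqxx muleC => E1.
  have -> : (\prod_(j <- J) Pr (U j @^-1` A j) = \prod_(j <- J) Pr (U j @^-1` A' j))%E.
    apply: eq_big_seq => j jJ; rewrite /A' ifF//.
    by apply/eqP => jn; rewrite jn (negbTE nJ) in jJ.
  rewrite -E1; congr (Pr _); apply/seteqP; split => x /=.
    move=> [H xB] j /=; rewrite inE /A' => /predU1P[->|jJ]; first by rewrite eqxx.
    by case: eqVneq => [->//|_]; exact: H.
  move=> H; split.
    move=> j /= jJ; have := H j; rewrite /= inE jJ orbT => /(_ isT).
    by rewrite /A' ifF//; apply/eqP => jn; rewrite jn (negbTE nJ) in jJ.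
  by have := H n; rewrite /= inE eqxx /A' eqxx => /(_ isT).
- move=> S mS; exact: (indepC (measurable_Uvec mS) mUB).
- move=> F mF tF IH; rewrite preimage_bigcup setI_bigcupl.
  have tUF : trivIset setT (fun k => Uvec @^-1` F k).
    by move=> k l _ _ [x [xk xl]]; apply: tF => //; exists (Uvec x).
  have mUF k : measurable (Uvec @^-1` F k) := measurable_Uvec (mF k).
  rewrite !measure_semi_bigcup//=.
  - rewrite -[Pr (U n @^-1` B)]fineK ?fin_num_measure// muleC -nneseriesZl//.
    by apply: eq_eseriesr => k _; rewrite fineK ?fin_num_measure// IH muleC.
  - exact: bigcupT_measurable.
  - by move=> k; exact: measurableI.
  - by move=> k l _ _ [x [[xk _] [xl _]]]; apply: tUF => //; exists x.
  - by apply: bigcupT_measurable => k; exact: measurableI.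
Qed.

Lemma uniform_itvco (c e : R) : 0 <= c -> c <= e -> e <= 1 ->
  uniform_prob (@ltr01 R) `[c, e[ = (e - c)%:E.
Proof.
move=> c0 ce e1; rewrite /uniform_prob integral_uniform_pdf setIidl; last first.
  move=> x /=; rewrite !in_itv/= => /andP[cx xe].
  by rewrite (le_trans c0 cx) (ltW (lt_le_trans xe e1)).
rewrite (eq_integral (cst 1%E)) => [|x]; last first.
  rewrite inE /= in_itv/= /uniform_pdf => /andP[cx xe].
  by rewrite (le_trans c0 cx) (ltW (lt_le_trans xe e1)) subr0 invr1.
rewrite integral_cst//= mul1e lebesgue_measure_itv/= lte_fin.
by case: ltP => // ec; rewrite (le_anti (_ : c <= e <= c)) ?subrr// ce ec.
Qed.

Lemma Pr_U_itvco i (c e : R) : 0 <= c -> c <= e -> e <= 1 ->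
  Pr (U i @^-1` `[c, e[) = (e - c)%:E.
Proof.
have [_ unif _] := U_iid => c0 ce e1.
by rewrite -(uniform_itvco c0 ce e1) -(unif i).
Qed.

End independence.

(** * The law of Phi(U) *)

Section law_of_Phi.
Variables (R : realType) (G : pointedType) (rk : G -> nat).
Hypothesis rk_inj : injective rk.
Variable P : G -> (nat -> G) -> R.
Hypothesis P_ge0 : forall g w, 0 <= P g w.
Hypothesis P_sum : forall w, (\esum_(g in [set: G]) (P g w)%:E = 1)%E.
Variables (d : measure_display) (T : measurableType d).
Variables (Pr : probability T R) (U : int -> {RV Pr >-> R}).
Hypothesis U_iid : iid_uniform U.

Let Uvec (x : T) : int -> R := fun i => U i x.
Let a := a_num P.
Notation before n := (g_sigma_algebraType (@past_cylinders R n)).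

(* The house-of-cards chain started at 0 at time [m] and driven by [u]; it is at
   0 at time [n + 1] whenever [tau P u n] is smaller than [m]. *)
Fixpoint run_length (u : int -> R) (m : int) (k : nat) : nat :=
  if k is l.+1 then
    let w := run_length u m l in if u (m + l%:Z) < a w then w.+1 else 0
  else 0.

(** The height of the chain is the length of a good run that ends just before [m + k]. *)
Lemma run_length_good u m k : (run_length u m k <= k)%N /\
  good_run P u (m + k%:Z - (run_length u m k)%:Z) (run_length u m k).
Proof.
elim: k => [|k [wk good]] /=; first by split.
case: ifP => uw; last by split.
split => // j; rewrite ltnS leq_eqVlt => /predU1P[->|jw].
  rewrite (_ : _ + _ = m + k%:Z)//; lia.
rewrite (_ : _ + _ = m + k%:Z - (run_length u m k)%:Z + j%:Z); first exact: good.
by lia.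
Qed.

(** A height [w.+1] at time [n + 1] would make [n - w] a run start for [n]. *)
Lemma tau_none_run_length u n k : tau P u n = None ->
  run_length u (n + 1 - k%:Z) k = 0%N.
Proof.
move=> tauN; have [wk good] := run_length_good u (n + 1 - k%:Z) k.
case w0 : (run_length _ _ _) wk good => [//|w] wk good.
have start : run_start P u n (n - w%:Z).
  split; first lia.
  rewrite (_ : `|(n - (n - w%:Z))%R|%N = w); last lia.
  rewrite (_ : n - w%:Z = n + 1 - k%:Z + k%:Z - w.+1%:Z)//; lia.
by have [r [tr _]] := tau_exists start; rewrite tauN in tr.
Qed.

Lemma measurable_run_length m k w n : m + k%:Z <= n ->
  measurable [set u : before n | run_length u m k = w].
Proof.
elim: k w => [|k IH] w kn /=.
  have [<-|ne] := pselect (0%N = w).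
    by rewrite (_ : [set _ | _] = setT)//; apply/seteqP; split.
  by rewrite (_ : [set _ | _] = set0)//; apply/seteqP; split.
have mlt c : measurable [set u : before n | u (m + k%:Z) < c].
  rewrite (_ : [set _ | _] = (fun u : before n => u (m + k%:Z)) @^-1` `]-oo, c[%classic).
    rewrite -[X in measurable X]setTI; apply: measurable_before_coord => //; lia.
  by apply/seteqP; split => x /=; rewrite in_itv.
rewrite (_ : [set _ | _] = \bigcup_v ([set u : before n | run_length u m k = v] `&`
  ([set u : before n | u (m + k%:Z) < a v] `&` [set _ | v.+1 = w] `|`
   ~` [set u : before n | u (m + k%:Z) < a v] `&` [set _ | 0%N = w]))).
  apply: bigcup_measurable => v _; apply: measurableI; first by apply: IH; lia.
  have mcst (Q : Prop) : measurable [set _ : before n | Q].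
    by have [q|nq] := pselect Q; [rewrite (_ : [set _ | _] = setT)//|
      rewrite (_ : [set _ | _] = set0)//]; apply/seteqP; split.
  by apply: measurableU; apply: measurableI => //; exact: measurableC.
apply/seteqP; split => u /=.
  move=> <-; exists (run_length u m k) => //; split; first by [].
  case: ifP => uw; first by left.
  by right; split => //=; rewrite uw.
move=> [v _ [/= ->]] [[-> //]|[uv <-]].
by rewrite ifF//; apply/negP.
Qed.

Lemma Pr_lt i v : Pr (U i @^-1` `]-oo, a v[) = (a v)%:E.
Proof.
have /andP[a0 a1] := a_num01 P_ge0 P_sum v.
have [u01 _ _] := U_iid.
rewrite -[a v in RHS]subr0 -(Pr_U_itvco U_iid i (lexx 0) a0 a1); congr (Pr _).
apply/seteqP; split => x /=; rewrite !in_itv/=; last by case/andP.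
by move=> ->; rewrite andbT; case/andP: (u01 i x).
Qed.

(** The state [v.+1] is entered only from [v], when the current variable is below [a v]; that
    variable is independent of the height reached so far. *)
Lemma Pr_run_length m k w :
  Pr (Uvec @^-1` [set u | run_length u m k = w])
  = (iter k (hoc_op a) (unit_mass R w) 0)%:E.
Proof.
elim: k w => [|k IH] w.
  rewrite /= /unit_mass; case: w => [|w].
    by rewrite (_ : _ @^-1` _ = setT) ?probability_setT//; apply/seteqP; split.
  by rewrite (_ : _ @^-1` _ = set0) ?measure0//; apply/seteqP; split.
have mW v : measurable ([set u | run_length u m k = v] : set (before (m + k%:Z))).
  exact: measurable_run_length.
have mlt v : measurable (`]-oo, a v[%classic : set R) by [].
have step v : Pr (Uvec @^-1` [set u | run_length u m k = v]
     `&` U (m + k%:Z) @^-1` `]-oo, a v[) = (a v * iter k (hoc_op a) (unit_mass R v) 0)%:E.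
  by rewrite before_independent// IH Pr_lt -EFinM mulrC.
have succ v : Pr (Uvec @^-1` [set u | run_length u m k.+1 = v.+1])
    = (iter k.+1 (hoc_op a) (unit_mass R v.+1) 0)%:E.
  rewrite iter_hoc_unit_massS -step; congr (Pr _); apply/seteqP; split => x /=.
    by rewrite in_itv/=; case: ifP => // uv [vE]; rewrite -vE.
  by rewrite in_itv/= => -[-> ->].
(* The state 0 receives the complementary probability, as both laws have total mass 1. *)
case: w => [|//].
pose F v : set T := Uvec @^-1` [set u | run_length u m k.+1 = v].
have mF v : measurable (F v).
  apply: (@measurable_Uvec _ _ _ _ U (m + k.+1%:Z)); exact: measurable_run_length.
have cover : \big[setU/set0]_(v < k.+2) F v = setT.
  rewrite -bigcup_mkord; apply/seteqP; split => // x _.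
  exists (run_length (Uvec x) m k.+1) => //=.
  by have [] := run_length_good (Uvec x) m k.+1.
have total : (1 = \sum_(v < k.+2) Pr (F v))%E.
  have E : (Pr (\big[setU/set0]_(v < k.+2) F v) = \sum_(v < k.+2) Pr (F v))%E.
    apply: (measure_semi_additive_ord Pr) => //.
      by move=> v w _ _ [x [/= vE wE]]; apply: val_inj; rewrite /= -vE -wE.
    by rewrite cover.
  by rewrite -E cover probability_setT.
have := iter_hoc_cst a k.+1 1 0.
rewrite (@iter_hoc_expand _ _ _ _ _ k.+2) ?add0n// big_ord_recl mul1r => total'.
move: total; rewrite big_ord_recl.
under [in X in (_ + X)%E]eq_bigr do rewrite succ.
rewrite sumEFin -[Pr (F _)]fineK ?fin_num_measure// -EFinD => -[E1].
have {}total' : iter k.+1 (hoc_op a) (unit_mass R 0) 0 +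
    \sum_(v < k.+1) iter k.+1 (hoc_op a) (unit_mass R v.+1) 0 = 1.
  by rewrite -[RHS]total'; congr (_ + _); apply: eq_bigr => v _; rewrite mul1r.
congr EFin; apply: addIr (etrans (esym E1) (esym total')).
Qed.

Hypothesis beta_oo : (\sum_(0 <= m <oo) (beta P m)%:E = +oo)%E.

(** For each [k], the chain started at time [n + 1 - k] is at 0 at time [n + 1] on this event, which
    bounds its probability by [hoc_rho a k]. *)
Lemma Pr_tau_none n : Pr (Uvec @^-1` [set u | tau P u n = None]) = 0%E.
Proof.
have mU j : j <= n -> measurable_fun setT (U j : T -> R) by [].
have mN : measurable (Uvec @^-1` [set u | tau P u n = None]).
  exact: (measurable_tau_none P mU (lexx n)).
apply/eqP; rewrite eq_le measure_ge0 andbT; apply/lee_addgt0Pr => e e0; rewrite add0e.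
have [k ke] := hoc_rho_small (a_num01 P_ge0 P_sum) (a_num_nd P_ge0 P_sum) beta_oo e0.
apply: (@le_trans _ _ (hoc_rho a k)%:E); last by rewrite lee_fin.
rewrite -(Pr_run_length (n + 1 - k%:Z)); apply: le_measure; rewrite ?inE//.
  apply: (@measurable_Uvec _ _ _ _ U (n + 1)).
  apply: measurable_run_length; lia.
by move=> x /=; exact: tau_none_run_length.
Qed.

Variable g0 : G.
Let X (x : T) : paths int G := Phi rk P g0 (Uvec x).

Lemma measurable_Phi_U : measurable_fun [set: T] X.
Proof.
apply: (measurable_to_paths rk_inj) => i g.
have mU j : j <= i -> measurable_fun setT (U j : T -> R) by [].
exact: (measurable_Phi rk_inj P_ge0 P_sum g0 mU g (lexx i)).
Qed.

(** The past of [Phi] at [i] uses only the variables before [i], whence its independence from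
    [U i]. *)
Lemma measurable_past_Phi i (C : set (paths nat G)) : measurable C ->
  measurable [set u : before i | C (past i (Phi rk P g0 u))].
Proof.
move=> mC; pose Y (u : before i) : paths nat G := past i (Phi rk P g0 u).
have mY : measurable_fun setT Y.
  apply: (measurable_to_paths rk_inj) => k g.
  have mV j : j <= i - k.+1%:Z -> measurable_fun setT ((fun u => u j) : before i -> R).
    by move=> ji; apply: measurable_before_coord; lia.
  exact: (measurable_Phi rk_inj P_ge0 P_sum g0 mV g (lexx _)).
by rewrite -[X in measurable X]setTI; exact: mY.
Qed.

Lemma Pr_B_int i h l g :
  Pr (U i @^-1` B_int rk P (mkseq h l) g) = (b_word P (mkseq h l) g)%:E.
Proof.
have c0 := b_cum_ge0 P_ge0 P_sum h l.
have c1 := b_cum_le1 P_ge0 P_sum h l.+1.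
have p0 := b_part_ge0 rk P_ge0 P_sum h l (rk g).
have p1 := b_part_le rk P_ge0 P_sum h l (rk g).+1.
have b0 := b_word_ge0 P_ge0 (mkseq h l) g.
have pS := b_partS rk_inj P_ge0 P_sum h l g.
rewrite B_int_itv// Pr_U_itvco//.
- by congr EFin; rewrite pS; ring.
- by rewrite addr_ge0.
- by rewrite pS; lra.
- lra.
Qed.

(** The interval lengths for [g] at the levels 0, ..., [k] telescope to [a_word]. *)
Lemma Pr_B_int_le i h k g :
  Pr (U i @^-1` [set v | exists2 l, (l <= k)%N & B_int rk P (mkseq h l) g v])
  = (a_word P (mkseq h k) g)%:E.
Proof.
pose B k := [set v | exists2 l, (l <= k)%N & B_int rk P (mkseq h l) g v].
have mb l : measurable (B_int rk P (mkseq h l) g) by exact: measurable_B_int.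
have mB j : measurable (B j).
  rewrite (_ : B j = \bigcup_(l in [set l | (l <= j)%N]) B_int rk P (mkseq h l) g).
    exact: bigcup_measurable.
  by apply/seteqP; split => v [l ? ?]; exists l.
rewrite -/(B k); elim: k => [|k IH].
  rewrite (_ : B 0%N = B_int rk P (mkseq h 0) g) ?Pr_B_int//.
  apply/seteqP; split => v; last by exists 0%N.
  by move=> [l]; rewrite leqn0 => /eqP->.
rewrite (_ : B k.+1 = B k `|` B_int rk P (mkseq h k.+1) g).
  rewrite preimage_setU.
  have -> : Pr (U i @^-1` B k `|` U i @^-1` B_int rk P (mkseq h k.+1) g)
      = (Pr (U i @^-1` B k) + Pr (U i @^-1` B_int rk P (mkseq h k.+1) g))%E.
    apply: (measureU Pr); [exact: measurable_Upreim|exact: measurable_Upreim|].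
    apply/seteqP; split => // x [[l lk vl] vk].
    by have := B_int_level rk_inj P_ge0 P_sum vl vk; lia.
  by rewrite IH Pr_B_int -EFinD b_wordS addrC subrK.
apply/seteqP; split => v.
  move=> [l]; rewrite leq_eqVlt => /predU1P[->|]; first by right.
  by left; exists l.
by case=> [[l lk vl]|vk]; [exists l => //; exact: leqW|exists k.+1].
Qed.

Lemma Phi_lower (mu : probability (paths int G) R) :
  (forall A, measurable A -> mu A = Pr (X @^-1` A)) -> lower_compatible P mu.
Proof.
move=> muE i g s C mC sC.
have mXi : measurable [set x : paths int G | x i = g] by exact: (measurable_coord i [set g]).
have mpC : measurable (past i @^-1` C : set (paths int G)) by exact: measurable_past_preim.
rewrite !muE//; last exact: measurableI.
pose E : set (before i) := [set u | C (past i (Phi rk P g0 u))].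
have mE : measurable E by exact: measurable_past_Phi.
pose h := prepend s (fun=> point : G).
have sE : s = mkseq h (size s) by rewrite mkseq_prepend.
pose B := [set v | exists2 l, (l <= size s)%N & B_int rk P (mkseq h l) g v].
have mB : measurable B.
  rewrite (_ : B = \bigcup_(l in [set l | (l <= size s)%N]) B_int rk P (mkseq h l) g).
    by apply: bigcup_measurable => l _; exact: measurable_B_int.
  by apply/seteqP; split => v [l ? ?]; exists l.
have -> : a_word P s g = a_word P (mkseq h (size s)) g by rewrite -sE.
rewrite -(Pr_B_int_le i) -/B muleC -(before_independent U_iid mE mB).
pose N := Uvec @^-1` [set u | tau P u i = None].
have mN : measurable N.
  have mU j : j <= i -> measurable_fun setT (U j : T -> R) by [].
  exact: (measurable_tau_none P mU (lexx i)).
have mX A : measurable A -> measurable (X @^-1` A).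
  by move=> mA; rewrite -[Y in measurable Y]setTI; exact: measurable_Phi_U.
set F := X @^-1` _.
have mF : measurable F by apply: mX; exact: measurableI.
(* The inclusion in [F] holds only where [tau] is finite; the exceptional set [N] has probability
   0. *)
apply: (@le_trans _ _ (Pr (F `|` N))).
  apply: le_measure; rewrite ?inE.
  - by apply: measurableI; [exact: measurable_Uvec|exact: measurable_Upreim].
  - exact: measurableU.
  move=> x [Cx [l ls vl]].
  have [tN|tS] := eqVneq (tau P (Uvec x) i) None; [by right|left].
  split=> //; have := sC _ Cx; rewrite [in RHS]sE => pE.
  have u0 j : 0 <= Uvec x j by have [/(_ j x)/andP[]] := U_iid.
  apply: (Phi_letter rk_inj P_ge0 P_sum u0 tS).
  (* An interval of level [l] depends on the last [l] letters only, and these agree with [s] because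
     [l <= size s]. *)
  by rewrite -(take_mkseq _ ls) -pE take_mkseq// in vl; exact: vl.
have : (Pr (F `|` N) <= Pr F + Pr N)%E by exact: (measureU2 Pr mF mN).
by rewrite /N Pr_tau_none adde0.
Qed.

End law_of_Phi.

Theorem corollary4p12 (R : realType) (G : pointedType) (rk : G -> nat)
    (rk_inj : injective rk) (P : G -> (nat -> G) -> R)
    (P_kernel : transition_kernel P) :
  (forall mu : probability (paths int G) R, compatible P mu ->
    forall (f : (int -> G) -> R) (s t i : int),
      s <= t -> i <= s -> bounded_fun f -> depends_on s t f ->
      forall w v : int -> G,
        `|cond_exp P i t f w - cond_exp P i t f v| <=
        2 * sup_norm f *
          \sum_(0 <= j < `|t - s|.+1) rho P (`|s - i| + j)%N)
  /\
  ((\sum_(0 <= m <oo) (beta P m)%:E = +oo)%E ->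
    forall (d : measure_display) (T : measurableType d) (Pr : probability T R)
      (U : int -> {RV Pr >-> R}) (g0 : G),
      iid_uniform U ->
      let X : T -> paths int G := fun x => Phi rk P g0 (fun i => U i x) in
      measurable_fun [set: T] X /\
      exists mu : probability (paths int G) R,
        [/\ forall A, measurable A -> mu A = pushforward Pr X A,
            compatible P mu
          & forall nu : probability (paths int G) R, compatible P nu ->
              forall A, measurable A -> nu A = mu A]).
Proof.
have [P_ge0 P_sum P_meas] := P_kernel; split.
  move=> mu _ f s t i st ls f_bnd f_dep w v.
  apply: (loss_of_memory P_ge0 P_sum) => // x.
  have [M [_ fM]] := f_bnd.
  apply: ub_le_sup; last by exists x.
  (* Boundedness of [f] is stated for every bound strictly above [M], such as [M + 1]. *)
  by exists (M + 1) => _ [y _ <-]; apply: fM => //; rewrite ltrDl.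
move=> beta_oo d T Pr U g0 U_iid X.
have mX : measurable_fun [set: T] X by exact: measurable_Phi_U.
split=> //.
pose mu : probability (paths int G) R := distribution Pr (mfun_Sub (mem_set mX)).
have muP : lower_compatible P mu.
  by apply: (Phi_lower rk_inj P_ge0 P_sum U_iid beta_oo (g0 := g0)) => A mA.
have a_near e : 0 < e -> exists k, 1 - a_num P k <= e.
  exact: (a_near1 (a_num01 P_ge0 P_sum) (a_num_nd P_ge0 P_sum) beta_oo).
exists mu; split => //.
  exact: (lower_compatible_compatible rk_inj P_ge0 P_sum P_meas).
move=> nu nuP; apply: (lower_compatible_unique rk_inj P_ge0 P_sum beta_oo) => //.
exact: compatible_lower.
Qed.
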